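(* Let $\mathcal K$ be a relational Fraïssé class which is Ramsey. If $G_\mathcal K$ is amenable, then $G_\mathcal K$ is uniquely ergodic, and the unique $G_\mathcal K$-invariant Borel probability measure on $M(G_\mathcal K)$ is concentrated on (i.e. gives measure $1$ to) an orbit which is dense $G_\delta$ in $M(G_\mathcal K)$; moreover this dense $G_\delta$ orbit is unique.
   Context: Structures are over a countable relational language $L$. A class $\mathcal K$ of finite $L$-structures is a Fraïssé class if it is hereditary, has joint embedding, has amalgamation, and contains arbitrarily large finite structures; $\mathrm{Flim}(\mathcal K)$ is its Fraïssé limit (the unique countable ultrahomogeneous structure with age $\mathcal K$), and $G_\mathcal K=\mathrm{Aut}(\mathrm{Flim}(\mathcal K))$ with the pointwise convergence topology. $\binom{B}{A}$ is the set of substructures of $B$ isomorphic to $A$; $C\to(B)^A_{k,d}$ means every colouring $\chi:\binom{C}{A}\to\{0,\dots,k-1\}$ admits $B'\in\binom{C}{B}$ with $|\chi(\binom{B'}{A})|\le d$; $\mathcal K$ is Ramsey if for all $A,B\in\mathcal K$ and $k\ge2$ there is $C\in\mathcal K$ with $C\to(B)^A_{k,1}$. $M(G)$ denotes the universal minimal $G$-flow (a $G$-flow is a continuous action on a compact Hausdorff space). $G$ is amenable if there exists a $G$-invariant Borel probability measure on $M(G)$, and uniquely ergodic if there is exactly one. *)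

(* Defs.v *)
From HB Require Import structures.
From mathcomp Require Import all_boot all_order all_algebra.
From mathcomp Require Import all_classical all_reals all_analysis.
From Stdlib Require List.
Set Implicit Arguments. Unset Strict Implicit. Unset Printing Implicit Defensive.
Import Order.TTheory GRing.Theory Num.Theory.
Local Open Scope classical_set_scope.

Record language := Language { sym : countType ; arity : sym -> nat }.

Record structure (L : language) := Structure {
  carrier :> Type ;
  rel : forall s : sym L, ('I_(arity s) -> carrier) -> Prop }.

Arguments rel {L} _ s _.

Definition embedding (L : language) (A B : structure L) (f : A -> B) : Prop :=
  injective f /\ forall (s : sym L) (t : 'I_(arity s) -> A), rel A s t <-> rel B s (f \o t).

Definition isomorphism (L : language) (A B : structure L) (f : A -> B) : Prop :=
  embedding f /\ bijective f.

Definition isomorphic (L : language) (A B : structure L) : Prop :=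
  exists f : A -> B, isomorphism f.

Definition embeds (L : language) (A B : structure L) : Prop :=
  exists f : A -> B, embedding f.

Definition finite_structure (L : language) (A : structure L) : Prop :=
  exists n (f : 'I_n -> A), bijective f.

Definition induced (L : language) (C : structure L) (S : set C) : structure L :=
  @Structure L {x : C | S x} (fun s t => rel C s (fun i => sval (t i))).

Definition class_of_finite (L : language) (K : structure L -> Prop) : Prop :=
  (forall A, K A -> finite_structure A) /\
  (forall A B, K A -> isomorphic A B -> K B).

Definition hereditary (L : language) (K : structure L -> Prop) : Prop :=
  forall A B : structure L, K A -> embeds B A -> K B.

Definition joint_embedding (L : language) (K : structure L -> Prop) : Prop :=
  forall A B, K A -> K B -> exists C, K C /\ embeds A C /\ embeds B C.

Definition amalgamation (L : language) (K : structure L -> Prop) : Prop :=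
  forall (A B1 B2 : structure L) (f1 : A -> B1) (f2 : A -> B2),
    K A -> K B1 -> K B2 -> embedding f1 -> embedding f2 ->
    exists (C : structure L) (g1 : B1 -> C) (g2 : B2 -> C),
      [/\ K C, embedding g1, embedding g2 & forall a, g1 (f1 a) = g2 (f2 a)].

Definition arbitrarily_large (L : language) (K : structure L -> Prop) : Prop :=
  forall n : nat, exists A : structure L, K A /\ exists f : 'I_n -> A, injective f.

Definition fraisse_class (L : language) (K : structure L -> Prop) : Prop :=
  [/\ class_of_finite K, hereditary K, joint_embedding K, amalgamation K
    & arbitrarily_large K].

Definition copies (L : language) (C A : structure L) : set (set C) :=
  [set S | isomorphic A (induced S)].
Arguments copies {L} C A.

Definition arrows (L : language) (C B A : structure L) (k : nat) : Prop :=
  forall chi : set C -> 'I_k,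
    exists2 B' : set C, copies C B B' &
      exists c : 'I_k, forall S : set C, copies C A S -> S `<=` B' -> chi S = c.

Definition ramsey_class (L : language) (K : structure L -> Prop) : Prop :=
  forall (A B : structure L) (k : nat), K A -> K B -> 2 <= k ->
    exists C : structure L, K C /\ arrows C B A k.

Definition countable_structure (L : language) (F : structure L) : Prop :=
  exists f : F -> nat, injective f.

Definition age_is (L : language) (F : structure L) (K : structure L -> Prop) : Prop :=
  forall A : structure L, finite_structure A -> (K A <-> embeds A F).

Definition automorphism (L : language) (F : structure L) (g : F -> F) : Prop :=
  isomorphism (A := F) (B := F) g.

Definition ultrahomogeneous (L : language) (F : structure L) : Prop :=
  forall (S1 S2 : set F) (p : induced S1 -> induced S2),
    finite_structure (induced S1) -> isomorphism p ->
    exists g : F -> F, automorphism g /\ forall x : induced S1, g (sval x) = sval (p x).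

Definition fraisse_limit (L : language) (K : structure L -> Prop)
    (F : structure L) : Prop :=
  countable_structure F /\ age_is F K /\ ultrahomogeneous F.

(* G-flows for G = Aut(F), with the pointwise convergence topology       *)

Section Flows.
Variable (L : language) (F : structure L).

(* basic neighbourhoods of g in Aut(F): automorphisms agreeing with g on a finite set *)
Definition agree_on (S : seq F) (g h : F -> F) : Prop :=
  forall n : F, List.In n S -> h n = g n.

Definition flow (X : topologicalType) (act : (F -> F) -> X -> X) : Prop :=
  [/\ compact [set: X], hausdorff_space X,
      forall x, act id x = x,
      forall g h x, automorphism g -> automorphism h ->
                    act (g \o h) x = act g (act h x)
    & forall g x (U : set X), automorphism g -> nbhs (act g x) U ->
        exists (S : seq F) (V : set X), nbhs x V /\
          forall h y, automorphism h -> agree_on S g h -> V y -> U (act h y)].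

Definition invariant_set (X : topologicalType) (act : (F -> F) -> X -> X)
    (A : set X) : Prop :=
  forall g x, automorphism g -> A x -> A (act g x).

Definition minimal_flow (X : topologicalType) (act : (F -> F) -> X -> X) : Prop :=
  [/\ flow act, [set: X] !=set0
    & forall A : set X, closed A -> invariant_set act A -> A = set0 \/ A = setT].

Definition flow_morphism (X Y : topologicalType) (actX : (F -> F) -> X -> X)
    (actY : (F -> F) -> Y -> Y) (f : X -> Y) : Prop :=
  continuous f /\ forall g x, automorphism g -> f (actX g x) = actY g (f x).

Definition universal_minimal_flow (M : topologicalType)
    (act : (F -> F) -> M -> M) : Prop :=
  minimal_flow act /\
  forall (Y : topologicalType) (actY : (F -> F) -> Y -> Y), minimal_flow actY ->
    exists f : M -> Y, flow_morphism act actY f /\ (forall y : Y, exists x : M, f x = y).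

Definition g_orbit (X : topologicalType) (act : (F -> F) -> X -> X) (x : X) : set X :=
  [set y | exists2 g, automorphism g & y = act g x].

Definition G_delta (X : topologicalType) (A : set X) : Prop :=
  exists U : nat -> set X, (forall n, open (U n)) /\ A = \bigcap_n U n.

End Flows.

Definition borel (X : ptopologicalType) := g_sigma_algebraType (@open X).

Definition invariant_measure (L : language) (F : structure L) (R : realType)
    (X : ptopologicalType) (act : (F -> F) -> X -> X)
    (mu : probability (borel X) R) : Prop :=
  forall g (A : set (borel X)), automorphism g -> measurable A ->
    mu (act g @^-1` A) = mu A.

(* Main.v *)
Require Import Defs.
From HB Require Import structures.
From mathcomp Require Import all_boot all_order all_algebra.
From mathcomp Require Import all_classical all_reals all_analysis.
From mathcomp Require Import measurable_realfun.
Set Implicit Arguments. Unset Strict Implicit. Unset Printing Implicit Defensive.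
Import Order.TTheory GRing.Theory Num.Theory.
Local Open Scope classical_set_scope.

(** Write [G] for the automorphism group of the limit.  Colouring the copies of
    a finite set by the order type they inherit from an arbitrary linear order,
    the Ramsey property and compactness give a linear order on the limit in
    which isomorphic finite substructures are order-isomorphic.  Its orbit
    closure [X] is a minimal flow in which all orders occurring on a finite set
    are conjugate under the setwise stabiliser of that set.  A second Ramsey
    argument shows that the morphism from the universal minimal flow to [X] is
    injective, so the cylinders "[l] is increasing" are a clopen base.  An
    invariant measure must be uniform on the cylinders over a given finite set,
    hence it is unique.

    The generic orders, those realising every admissible one-point extension of
    a finite increasing list, form a G_delta set and, by back and forth, a
    single orbit.  The point is that they have full measure.  If the admissible
    position of [b] over a finite list is not determined, two positions of [b]
    are exchanged by an automorphism that rotates the segment between them.  The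
    orbit of [b] over the list is then infinite, since otherwise a proper
    colouring of a graph of bounded degree would contradict the Ramsey property.
    As both positions have positive measure, arbitrarily many points of the orbit
    simultaneously realise the first position in one order and the second
    position in another one.  Comparing the two orders, the segment can be moved
    onto disjoint blocks of these points in such a way that the events "the first
    position is not realised" become pairwise disjoint events of equal measure,
    so that this measure vanishes. *)

(** * Permutation groups and the Ramsey property *)

(** A predicate on plain functions, so that it applies directly to flows, whose actions take
    arbitrary functions as arguments. *)
Record permgroup (T : Type) := PermGroup {
  pg_set :> (T -> T) -> Prop ;
  pg1 : pg_set id ;
  pgM : forall g h, pg_set g -> pg_set h -> pg_set (g \o h) ;
  pg_inv : forall g, pg_set g ->
    exists2 h, pg_set h & cancel g h /\ cancel h g }.

(** Total and independent of the group, with the default value [id] on maps that are not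
    invertible. *)
Definition ginv (T : Type) (g : T -> T) : T -> T :=
  if pselect (exists h, cancel g h /\ cancel h g) is left gP
  then projT1 (cid gP) else id.

Section PermGroup.
Variables (T : Type) (G : permgroup T).
Implicit Types g h : T -> T.

Lemma ginv_spec g : G g -> [/\ G (ginv g), cancel g (ginv g) & cancel (ginv g) g].
Proof.
move=> Gg; have [h Gh [gh hg]] := pg_inv Gg.
rewrite /ginv; case: pselect => [gP|[]]; last by exists h.
case: (cid gP) => k [gk kg] /=; split=> //.
suff -> : k = h by [].
by apply/funext => x; rewrite -{1}(hg x) gk.
Qed.

Lemma ginv_in g : G g -> G (ginv g).
Proof. by move=> /ginv_spec[]. Qed.

Lemma ginvK g : G g -> cancel g (ginv g).
Proof. by move=> /ginv_spec[]. Qed.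

Lemma Kginv g : G g -> cancel (ginv g) g.
Proof. by move=> /ginv_spec[]. Qed.

Lemma G_inj g : G g -> injective g.
Proof. by move=> /ginvK /can_inj. Qed.

Lemma ginv_eq g h : G g -> cancel g h -> ginv g = h.
Proof.
by move=> Gg gh; apply/funext => x; rewrite -[in RHS](Kginv Gg x) gh.
Qed.

Lemma ginvV g : G g -> ginv (ginv g) = g.
Proof. by move=> Gg; apply: ginv_eq; [exact: ginv_in|exact: Kginv]. Qed.

Lemma ginvM g h : G g -> G h -> ginv (g \o h) = ginv h \o ginv g.
Proof.
move=> Gg Gh; apply: ginv_eq; first exact: pgM.
by move=> x /=; rewrite !ginvK.
Qed.

Lemma ginv1 : ginv id = id :> (T -> T).
Proof. by apply: ginv_eq => //; exact: pg1. Qed.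

Lemma comp_can g : G g -> ginv g \o g = id.
Proof. by move=> Gg; apply/funext => x /=; rewrite ginvK. Qed.

End PermGroup.

(** The Ramsey property read inside the limit, where by homogeneity the copies of [s] are its images
    under the group. The colouring sees these images as sets: copies are coloured, not
    embeddings. *)
Definition ramsey_group (T : eqType) (G : permgroup T) :=
  forall (K : finType) (s t : seq T), exists c : seq T,
  forall chi : set T -> K, exists h, [/\ G h, {subset map h t <= c} &
    exists k, forall g, G g -> {subset map g s <= map h t} ->
      chi [set` map g s] = k].

Lemma set_map_seq (T : eqType) (g : T -> T) (s : seq T) :
  g @` [set` s] = [set` map g s].
Proof.
apply/seteqP; split=> x /=.
  by case=> y ys <-; exact: map_f.
by case/mapP => y ys ->; exists y.
Qed.

Lemma set_seq_eq (T : eqType) (s t : seq T) : [set` s] = [set` t] -> s =i t.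
Proof. by move=> st x; have := congr1 (fun A => `[< A x >]) st; rewrite /= !asboolb. Qed.

Section RamseyFlow.
Variables (T : choiceType) (G : permgroup T).
Hypothesis ram : ramsey_group G.

(** Induction on the indices: the set [c] that is Ramsey for the new index is the target for the
    remaining ones, and the resulting [h] pulls the new colouring back to copies inside [c]. *)
Lemma multi_ramsey (I : eqType) (s : I -> seq T) (chi : I -> set T -> bool)
    (l : seq I) (t : seq T) :
  exists2 h, G h & forall i, i \in l -> exists k, forall g, G g ->
    {subset map g (s i) <= map h t} -> chi i [set` map g (s i)] = k.
Proof.
elim: l t => [|i l IHl] t; first by exists id => //; exact: pg1.
have [c cP] := ram bool (s i) t.
have [h Gh hP] := IHl c.
have [h' [Gh' h't [k kP]]] := cP (fun S => chi i (h @` S)).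
exists (h \o h'); first exact: pgM.
have sub : {subset map (h \o h') t <= map h c}.
  by move=> _ /mapP[x xt ->] /=; apply/map_f/h't/map_f.
move=> j; rewrite inE => /predU1P[->{j}|jl]; last first.
  have [k' k'P] := hP j jl; exists k' => g Gg gs.
  by apply: k'P => // x /gs /sub.
exists k => g Gg gs.
have -> : g = h \o (ginv h \o g) by apply/funext => x /=; rewrite (Kginv Gh).
rewrite map_comp -set_map_seq; apply: kP.
  by apply: pgM => //; exact: ginv_in.
move=> _ /mapP[x xs ->] /=.
have /mapP[y yt ->] := gs _ (map_f g xs).
by rewrite /= (ginvK Gh); exact: map_f.
Qed.

Variables (Y : ptopologicalType) (act : (T -> T) -> Y -> Y).
Hypothesis Ycompact : compact [set: Y].
Hypothesis actM : forall g h y, G g -> G h -> act (g \o h) y = act g (act h y).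
Hypothesis act_cont : forall g, G g -> continuous (act g).

(* Ramsey turns a two-colouring condition that holds along the orbit of [y0]
   copy by copy into one that holds uniformly along the orbit of some [y]. *)
Lemma ramsey_flow (y0 : Y) (J : choiceType) (s : J -> seq T)
    (F : J -> bool -> set Y) (chi : J -> set T -> bool) :
  (forall i b, closed (F i b)) ->
  (forall i g, G g -> F i (chi i [set` map (ginv g) (s i)]) (act g y0)) ->
  exists y, forall i, exists b, forall g, G g -> F i b (act g y).
Proof.
move=> Fclosed FP.
(* [Q (i, t)] asks for uniformity only over the copies inside the finite set [t]. These sets are
   closed, and [multi_ramsey] gives the finite intersection property. *)
pose Q (p : J * seq T) : set Y := [set y | exists b, forall g, G g ->
  {subset map (ginv g) (s p.1) <= p.2} -> F p.1 b (act g y)].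
have Qclosed p : closed (Q p).
  have -> : Q p = \bigcup_(b in [set: bool])
      \bigcap_(g in [set g | G g /\ {subset map (ginv g) (s p.1) <= p.2}])
        act g @^-1` F p.1 b.
    apply/seteqP; split=> y /=.
      by case=> b bP; exists b => // g [Gg gs]; exact: bP.
    by case=> b _ bP; exists b => g Gg gs; exact: bP.
  apply: closed_bigcup => //; first exact: finite_finset.
  move=> b _; apply: closed_bigI => g [Gg _].
  by apply: preimage_closed; [move=> ? _; exact: act_cont|exact: Fclosed].
have [y yP] : \bigcap_(p in setT) Q p !=set0.
  move: Ycompact; rewrite compact_In0 => /(_ _ setT Q); apply.
    by exists Q => // p _; rewrite setTI.
  move=> D' _.
  pose t := flatten [seq p.2 | p <- finmap.enum_fset D'].
  have [h Gh hP] := multi_ramsey s chi [seq p.1 | p <- finmap.enum_fset D'] t.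
  exists (act (ginv h) y0) => p /= pD'.
  have [k kP] := hP p.1 (map_f _ pD').
  exists k => g Gg gs; rewrite -actM //; last exact: ginv_in.
  have Ggh : G (g \o ginv h) by apply: pgM => //; exact: ginv_in.
  have := FP p.1 _ Ggh; rewrite (ginvM Gg (ginv_in Gh)) (ginvV Gh) kP//.
    by apply: pgM => //; exact: ginv_in.
  rewrite map_comp => x /mapP[z /gs zp ->]; apply: map_f.
  by apply/flattenP; exists p.2 => //; exact: map_f.
(* If each colour failed at some group element, a finite set containing both offending copies would
   contradict membership of [y] in the corresponding [Q]. *)
exists y => i; apply: contrapT => /forallNP nP.
have nP' b : exists2 g, G g & ~ F i b (act g y).
  by have /existsNP[g /not_implyP[Gg nF]] := nP b; exists g.
have [g0 Gg0 nF0] := nP' false; have [g1 Gg1 nF1] := nP' true.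
have [b bP] := yP (i, map (ginv g0) (s i) ++ map (ginv g1) (s i)) I.
case: b bP => bP; [apply: nF1|apply: nF0]; apply: bP => // x xs;
  by rewrite mem_cat /= xs ?orbT.
Qed.

End RamseyFlow.

(** * Relations on a countable set *)

Definition gflow (T : eqType) (G : permgroup T) (X : topologicalType)
    (act : (T -> T) -> X -> X) : Prop :=
  [/\ compact [set: X], hausdorff_space X, forall x, act id x = x,
      forall g h x, G g -> G h -> act (g \o h) x = act g (act h x)
    & forall g x (U : set X), G g -> nbhs (act g x) U ->
        exists (s : seq T) (V : set X), nbhs x V /\
          forall h y, G h -> {in s, h =1 g} -> V y -> U (act h y)].

Definition gminimal (T : eqType) (G : permgroup T) (X : topologicalType)
    (act : (T -> T) -> X -> X) : Prop :=
  [/\ gflow G act, [set: X] !=set0 & forall A : set X, closed A ->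
      (forall g x, G g -> A x -> A (act g x)) -> A = set0 \/ A = setT].

(** Otherwise the closed sets [B s] minus the interior of [U] have the finite intersection property,
    and a common point would have to be [y]. *)
Lemma compact_base (Y : ptopologicalType) (T : choiceType) (B : seq T -> set Y)
    (y : Y) (U : set Y) :
  compact [set: Y] -> (forall s, closed (B s)) ->
  (forall s t, {subset s <= t} -> B t `<=` B s) ->
  (forall z, (forall s, B s z) -> z = y) -> nbhs y U -> exists s, B s `<=` U.
Proof.
move=> cY Bcl Bmono By nU; apply: contrapT => /forallNP nB.
have [z zP] : \bigcap_(s in [set: seq T]) (B s `&` ~` U^°) !=set0.
  move: cY; rewrite compact_In0 => /(_ _ setT (fun s => B s `&` ~` U^°)); apply.
    exists (fun s => B s `&` ~` U^°); last by move=> i _; rewrite setTI.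
    by move=> s _; apply: closedI => //; apply/open_closedC/open_interior.
  move=> D' _; pose t := flatten (finmap.enum_fset D').
  have /existsNP[z /not_implyP[Bz nUz]] := nB t.
  exists z => s /= sD'; split; last by move=> /interior_subset.
  by apply: Bmono Bz => a sa; apply/flattenP; exists s.
have zy : z = y by apply: By => s; case: (zP s Logic.I).
by case: (zP [::] Logic.I) => _; apply; rewrite zy.
Qed.

Definition relspace (T : Type) : Type := prod_topology (fun _ : T * T => bool).

HB.instance Definition _ (T : Type) := Topological.copy (relspace T)
  (prod_topology (fun _ : T * T => bool)).
HB.instance Definition _ (T : Type) :=
  isPointed.Build (relspace T) (fun _ : T * T => false).

Section RelSpace.
Variable T : choiceType.
Implicit Types (R P : relspace T) (s : seq T).

Definition eqon s R P := forall a b, a \in s -> b \in s -> R (a, b) = P (a, b).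

Lemma eqon_sym s R P : eqon s R P -> eqon s P R.
Proof. by move=> RP a b sa sb; rewrite RP. Qed.

Lemma eqon_trans s R P Q : eqon s R P -> eqon s P Q -> eqon s R Q.
Proof. by move=> RP PQ a b sa sb; rewrite RP// PQ. Qed.

Lemma relspace_compact : compact [set: relspace T].
Proof.
have := @tychonoff (T * T)%type (fun _ => bool) (fun _ => setT)
  (fun _ => bool_compact).
by congr compact; apply/seteqP; split.
Qed.

Lemma relspace_hausdorff : hausdorff_space (relspace T).
Proof.
by apply: (@hausdorff_product (T * T)%type (fun _ => bool)) => ?;
  exact: discrete_hausdorff.
Qed.

Lemma near_eqon s R : nbhs R (eqon s R).
Proof.
suff near_seq (l : seq (T * T)) :
    nbhs R [set P : relspace T | {in l, forall p, R p = P p}].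
  apply: filterS (near_seq [seq (a, b) | a <- s, b <- s]) => P RP a b sa sb.
  by apply: RP; exact: allpairs_f.
elim: l => [|p l IHl]; first by apply: filterS filterT => P _ ?.
have np : nbhs R [set P : relspace T | R p = P p].
  apply: (@proj_continuous (T * T)%type (fun _ => bool) p R [set b | R p = b]).
  by rewrite nbhs_principalE //=.
apply: filterS (filterI np IHl) => P [/= Rp Rl] q.
by rewrite inE => /predU1P[->|]; [|exact: Rl].
Qed.

Lemma eqon_open s (Q : set (relspace T)) :
  (forall R P, eqon s R P -> Q R -> Q P) -> open Q.
Proof.
move=> Qs; rewrite openE => R QR; rewrite /interior.
by apply: filterS (near_eqon s R) => P /Qs; apply.
Qed.

Lemma eqon_closed s (Q : set (relspace T)) :
  (forall R P, eqon s R P -> Q R -> Q P) -> closed Q.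
Proof.
move=> Qs; rewrite -[Q]setCK; apply/open_closedC/(@eqon_open s).
by move=> R P RP nQ QP; apply: nQ; apply: Qs QP; exact: eqon_sym.
Qed.

Lemma nbhs_eqon R (U : set (relspace T)) :
  nbhs R U -> exists s, eqon s R `<=` U.
Proof.
apply: compact_base.
- exact: relspace_compact.
- move=> s; apply: (@eqon_closed s) => P Q PQ RP; exact: eqon_trans PQ.
- by move=> s t st P RP a b /st sa /st sb; exact: RP.
- move=> P RP; apply/funext => -[a b].
  by rewrite (RP [:: a; b])// !inE eqxx ?orbT.
Qed.

Definition linord R := forall a b c, [/\ ~~ R (a, a),
  R (a, b) -> R (b, c) -> R (a, c) & a != b -> R (a, b) || R (b, a)].

Lemma linord_closed : closed linord.
Proof.
have -> : linord = \bigcap_(p in [set: T * T * T])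
    [set R | [/\ ~~ R (p.1.1, p.1.1),
      R (p.1.1, p.1.2) -> R (p.1.2, p.2) -> R (p.1.1, p.2)
      & p.1.1 != p.1.2 -> R (p.1.1, p.1.2) || R (p.1.2, p.1.1)]].
  apply/seteqP; split=> R /= RP; first by move=> p _; exact: RP.
  by move=> a b c; exact: (RP (a, b, c)).
apply: closed_bigI => -[[a b] c] _ /=.
apply: (@eqon_closed [:: a; b; c]) => R P RP /=.
by rewrite !RP// !inE eqxx ?orbT.
Qed.

Variable G : permgroup T.
Implicit Types g h : T -> T.

Definition ract g R : relspace T := fun p => R (ginv g p.1, ginv g p.2).

Lemma ract1 R : ract id R = R.
Proof. by apply/funext => -[a b]; rewrite /ract (ginv1 G). Qed.

Lemma ractM g h R : G g -> G h -> ract (g \o h) R = ract g (ract h R).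
Proof. by move=> Gg Gh; apply/funext => -[a b]; rewrite /ract (ginvM Gg Gh). Qed.

Lemma eqon_ract s g R P : eqon (map (ginv g) s) R P -> eqon s (ract g R) (ract g P).
Proof. by move=> RP a b sa sb; apply: RP; exact: map_f. Qed.

Lemma ract_continuous g : continuous (ract g).
Proof.
move=> R U /= /nbhs_eqon[s sU]; rewrite nbhs_simpl /=.
apply: filterS (near_eqon (map (ginv g) s) R) => P RP /=.
by apply: sU; exact: eqon_ract.
Qed.

Lemma linord_ract g R : G g -> linord R -> linord (ract g R).
Proof.
move=> Gg lR a b c; have [irr tr tot] := lR (ginv g a) (ginv g b) (ginv g c).
split=> // ab; apply: tot; apply: contra ab => /eqP/(G_inj (ginv_in Gg)) ->.
exact: eqxx.
Qed.

(** Conjugacy of the restrictions to [s] under the setwise stabiliser of [s] in [G]; the conjugating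
    map must lie in [G], which is more than an isomorphism of the restrictions. *)
Definition sim s R P := exists2 h, G h &
  map h s =i s /\ forall a b, a \in s -> b \in s -> R (a, b) = P (h a, h b).

Lemma eqon_sim s R P : eqon s R P -> sim s R P.
Proof. by move=> RP; exists id; [exact: pg1|rewrite map_id]. Qed.

Lemma sim_sym s R P : sim s R P -> sim s P R.
Proof.
move=> [h Gh [hs RP]]; exists (ginv h); first exact: ginv_in.
have hV a : a \in s -> ginv h a \in s.
  by rewrite -{1}(hs a) => /mapP[b sb ->]; rewrite (ginvK Gh).
split=> [a|a b sa sb]; last first.
  by rewrite RP ?hV// !(Kginv Gh).
apply/mapP/idP => [[b sb ->]|sa]; first exact: hV.
by exists (h a); [rewrite -(hs (h a)) map_f|rewrite (ginvK Gh)].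
Qed.

Lemma sim_trans s R P Q : sim s R P -> sim s P Q -> sim s R Q.
Proof.
move=> [h Gh [hs RP]] [k Gk [ks PQ]]; exists (k \o h); first exact: pgM.
have hin a : a \in s -> h a \in s by move=> sa; rewrite -(hs (h a)) map_f.
split=> [a|a b sa sb]; last by rewrite RP// PQ ?hin.
by rewrite map_comp -(ks a); apply: eq_mem_map.
Qed.

(** The map [h \o ginv g] stabilises [s]. Hence the similarity class of [ract g R] on [s] depends
    only on the preimage of [s] as a set, and can colour that copy. *)
Lemma ract_sim s g h R : G g -> G h -> map (ginv g) s =i map (ginv h) s ->
  sim s (ract g R) (ract h R).
Proof.
move=> Gg Gh gh; exists (h \o ginv g).
  by apply: pgM => //; exact: ginv_in.
split=> [a|a b sa sb]; last by rewrite /ract /= !(ginvK Gh).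
rewrite map_comp (eq_mem_map _ gh) -map_comp.
by rewrite (eq_map (g := id)) ?map_id// => x /=; rewrite (Kginv Gh).
Qed.

End RelSpace.

(** * The flow of uniform orders *)

Lemma set_type_compact (Y : topologicalType) (X : set Y) :
  compact X -> compact [set: set_type X].
Proof.
move=> cX F PF _.
have FX : (set_val @ F) X.
  rewrite /fmap /=; apply: filterS filterT => x _ /=; exact: set_valP.
have [p [Xp clp]] := cX (set_val @ F) _ FX.
exists (exist _ p (mem_set Xp)); split=> // A B FA [_ [[W oW <-] Wp WB]].
have [_ [[a Aa <-] Wa]] : set_val @` A `&` W !=set0.
  apply: clp; last exact: open_nbhs_nbhs.
  by rewrite /fmap /=; apply: filterS FA => a Aa /=; exists a.
by exists a; split=> //; exact: WB.
Qed.

Section OrderFlow.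
Variables (T : countType) (G : permgroup T).
Hypothesis ram : ramsey_group G.

(** Similarity to [P] on [s] is a two-colouring, one for each [P]. Once all of these are constant
    along the orbit of [x0], taking [x0] itself for [P] gives the claim. *)
Lemma uniform_order : exists2 x0 : relspace T, linord x0 &
  forall s g, G g -> sim G s (ract g x0) x0.
Proof.
(* The index [None] carries the closed condition of being a linear order over to [x0]. *)
pose J := option (seq T * relspace T)%type.
pose y0 : relspace T := fun p => (pickle p.1 < pickle p.2)%N.
pose sJ (i : J) := if i is Some p then p.1 else [::].
pose F (i : J) b : set (relspace T) := if i is Some p
  then [set R | `[< sim G p.1 R p.2 >] = b] else @linord T.
pose chi (i : J) (S : set T) : bool := if i is Some p
  then `[< exists2 g, G g & [set` map (ginv g) p.1] = S /\
           sim G p.1 (ract g y0) p.2 >] else true.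
have ly0 : linord y0.
  move=> a b c; split=> /=; [by rewrite /y0 ltnn|exact: ltn_trans|].
  by rewrite /y0 /= -neq_ltn; apply: contra => /eqP/(pcan_inj pickleK) ->.
have := ramsey_flow ram (@relspace_compact T)
    (@ractM T G) (fun g _ => @ract_continuous T g) (y0 := y0)
    (s := sJ) (F := F) (chi := chi) => -[||x0 x0P].
- move=> [[s P]|] b /=; last exact: linord_closed.
  apply: (@eqon_closed _ s) => R Q RQ /= <-; apply: asbool_equiv_eq.
  by split=> RP; apply: (sim_trans _ RP); apply: eqon_sim => //; exact: eqon_sym.
- move=> [[s P]|] g Gg /=; last exact: (linord_ract Gg ly0).
  apply: asbool_equiv_eq; split=> [simP|]; first by exists g.
  move=> [h Gh [/set_seq_eq hg hP]]; apply: (sim_trans _ hP).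
  by apply: ract_sim => // a; rewrite hg.
exists x0.
  by have [b /(_ _ (pg1 G))] := x0P None; rewrite (ract1 G).
move=> s g Gg; have [b bP] := x0P (Some (s, x0)).
have simb h : G h -> `[< sim G s (ract h x0) x0 >] = b by exact: bP.
apply/asboolP; rewrite (simb _ Gg) -(simb _ (pg1 G)) (ract1 G).
by apply/asboolP/eqon_sim.
Qed.

Lemma order_flow : exists (Y : topologicalType) (act : (T -> T) -> Y -> Y)
    (v : Y -> relspace T),
  [/\ gminimal G act, continuous v,
      forall g y, G g -> v (act g y) = ract g (v y),
      forall y, linord (v y)
    & forall s y z, sim G s (v y) (v z)].
Proof.
have [x0 lx0 simx0] := uniform_order.
(* The orbit closure of [x0], described through finite windows. *)
pose X : set (relspace T) := [set x | forall s,
  exists2 g, G g & eqon s x (ract g x0)].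
have Xx0 : X x0 by move=> s; exists id; [exact: pg1|rewrite (ract1 G)].
have Xsim0 s x : X x -> sim G s x x0.
  by move=> /(_ s)[g Gg xg]; apply: sim_trans (simx0 s g Gg); exact: eqon_sim.
have Xact g x : G g -> X x -> X (ract g x).
  move=> Gg Xx s; have [h Gh xh] := Xx (map (ginv g) s).
  exists (g \o h); first exact: pgM.
  by rewrite (ractM _ Gg Gh); exact: eqon_ract.
have Xclosed : closed X.
  have -> : X = \bigcap_(s in [set: seq T])
      [set x | exists2 g, G g & eqon s x (ract g x0)].
    by apply/seteqP; split=> x /= xX s; [move=> _|]; exact: xX.
  apply: closed_bigI => s _; apply: (@eqon_closed _ s) => R P RP [g Gg Rg].
  by exists g => //; apply: eqon_trans Rg; exact: eqon_sym.
have Xlin x : X x -> linord x.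
  move=> Xx a b c; have [g Gg xg] := Xx [:: a; b; c].
  have := linord_ract Gg lx0 a b c.
  by rewrite -!xg// !inE eqxx ?orbT.
pose Y := set_type X.
have valP (y : Y) : X (set_val y) := set_valP y.
pose act (g : T -> T) (y : Y) : Y := match pselect (G g) with
  | left Gg => exist _ (ract g (set_val y)) (mem_set (Xact g _ Gg (valP y)))
  | right _ => y end.
have actE g y : G g -> set_val (act g y) = ract g (set_val y).
  by move=> Gg; rewrite /act; case: pselect.
have val_inj : injective (set_val : Y -> relspace T).
  by move=> y z; rewrite !set_valE => /val_inj.
have val_cont : continuous (set_val : Y -> relspace T).
  exact: initial_continuous.
have nbhsY (y : Y) (U : set Y) : nbhs y U ->
    exists s, forall z, eqon s (set_val y) (set_val z) -> U z.
  move=> [_ [[W oW <-] Wy WU]].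
  have [s sW] := nbhs_eqon (open_nbhs_nbhs (conj oW Wy)).
  by exists s => z yz; apply: WU; exact: sW.
exists Y, act, set_val; split=> //.
- split.
  + split.
    * apply: set_type_compact.
      by apply: (subclosed_compact Xclosed (@relspace_compact T)).
    * move=> y z yz; apply: val_inj; apply: relspace_hausdorff => A B yA zB.
      have [w [Aw Bw]] := yz _ _ (val_cont _ _ yA) (val_cont _ _ zB).
      by exists (set_val w).
    * move=> y; apply: val_inj; rewrite actE; last exact: pg1.
      by rewrite (ract1 G).
    * move=> g h y Gg Gh; apply: val_inj.
      by rewrite !actE ?(ractM _ Gg Gh)//; exact: pgM.
    * move=> g y U Gg /nbhsY[s sU].
      exists (map (ginv g) s), (set_val @^-1` eqon (map (ginv g) s) (set_val y)).
      split; first by apply: val_cont; exact: near_eqon.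
      move=> h z Gh hg yz; apply: sU; rewrite !actE//.
      have hgV a : a \in s -> ginv h a = ginv g a.
        move=> sa; apply: (G_inj Gh); rewrite (Kginv Gh) hg ?map_f//.
        by rewrite (Kginv Gg).
      by move=> a b sa sb; rewrite /ract /= !hgV//; apply: yz; exact: map_f.
  + by exists (exist _ x0 (mem_set Xx0)).
  + move=> A Acl Ainv.
    have [->|/set0P[y Ay]] := eqVneq A set0; [by left|right].
    apply/seteqP; split=> // z _; apply: Acl => U /nbhsY[s sU].
    (* Any two points of [X] are conjugate on each finite window, so a translate of [y] agrees with
       [z] there; this gives minimality. *)
    have [h Gh [hs zy]] : sim G s (set_val z) (set_val y).
      by apply: sim_trans (Xsim0 _ _ (valP z)) (sim_sym (Xsim0 _ _ (valP y))).
    exists (act (ginv h) y); split; first by apply: Ainv => //; exact: ginv_in.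
    apply: sU; rewrite actE; last exact: ginv_in.
    by move=> a b sa sb; rewrite /ract /= (ginvV Gh) zy.
- by move=> y; exact: Xlin.
- move=> s y z; exact: sim_trans (Xsim0 _ _ (valP y)) (sim_sym (Xsim0 _ _ (valP z))).
Qed.

End OrderFlow.

(** * Equivariant families of orders *)

(** A continuous equivariant map to linear orders, any two values being conjugate on each finite
    set. [go_sim] is [sim] spelled out for [lt]. *)
Record gorder (T : eqType) (G : permgroup T) (M : topologicalType)
    (act : (T -> T) -> M -> M) (lt : M -> rel T) : Prop := GOrder {
  go_open : forall a b, open [set m | lt m a b] ;
  go_irr : forall m, irreflexive (lt m) ;
  go_tr : forall m, transitive (lt m) ;
  go_tot : forall m a b, a != b -> lt m a b || lt m b a ;
  go_act : forall g m a b, G g -> lt (act g m) (g a) (g b) = lt m a b ;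
  go_sim : forall s m n, exists2 h, G h & map h s =i s /\
    forall a b, a \in s -> b \in s -> lt m a b = lt n (h a) (h b) }.

(** Lets the null-set argument assume that the second position of [b] lies above the first. *)
Lemma gorder_rev (T : eqType) (G : permgroup T) (M : topologicalType)
    (act : (T -> T) -> M -> M) (lt : M -> rel T) :
  gorder G act lt -> gorder G act (fun m a b => lt m b a).
Proof.
move=> [op irr tr tot ac sm]; split=> //.
- by move=> m b a c ba cb; exact: tr cb ba.
- by move=> m a b ab; rewrite orbC; exact: tot.
- by move=> g m a b Gg; exact: ac.
- move=> s m n; have [h Gh [hs hP]] := sm s m n; exists h => //.
  by split=> // a b sa sb; exact: hP.
Qed.

Section Orders.
Variables (T : eqType) (G : permgroup T) (M : topologicalType).
Variables (act : (T -> T) -> M -> M) (lt : M -> rel T).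
Hypothesis O : gorder G act lt.
Implicit Types (m n : M) (a b : T) (l k s : seq T) (g h : T -> T).

Let tr m : transitive (lt m). Proof. exact: (@go_tr _ _ _ _ _ O m). Qed.
Let irr m : irreflexive (lt m). Proof. exact: (@go_irr _ _ _ _ _ O m). Qed.

Definition cyl l : set M := [set m | sorted (lt m) l].

Lemma sorted_uniq_lt m l : sorted (lt m) l -> uniq l.
Proof. exact: sorted_uniq (@tr m) (@irr m) _. Qed.

Lemma sorted_insert m l b : b \notin l -> sorted (lt m) l ->
  exists k1 k2, l = k1 ++ k2 /\ sorted (lt m) (k1 ++ b :: k2).
Proof.
elim: l => [|a l IHl]; first by exists [::], [::].
rewrite inE negb_or => /andP[ba bl] sal.
have := sal; rewrite /= (path_sortedE (@tr m)) => /andP[al sl].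
have [lba|lab] := boolP (lt m b a).
  by exists [::], (a :: l); split=> //=; rewrite lba.
have {lab}ab : lt m a b by have := go_tot O m ba; rewrite (negbTE lab).
have [k1 [k2 [lE sk]]] := IHl bl sl.
exists (a :: k1), k2; rewrite lE; split=> //.
rewrite cat_cons /= (path_sortedE (@tr m)) sk andbT.
by move: al; rewrite lE !all_cat /= ab => /andP[-> ->].
Qed.

Lemma exists_sorted m s : exists2 l, sorted (lt m) l & l =i s.
Proof.
elim: s => [|a s [l sl ls]]; first by exists [::].
have [al|al] := boolP (a \in l).
  exists l => // x; rewrite inE ls; case: eqP => // ->; by rewrite -ls al.
have [k1 [k2 [lE sk]]] := sorted_insert al sl.
exists (k1 ++ a :: k2) => // x.
by rewrite mem_cat !inE -ls lE mem_cat orbCA.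
Qed.

Lemma sorted_eq_lt m l k : l =i k -> sorted (lt m) l -> sorted (lt m) k -> l = k.
Proof. by move=> lk sl sk; apply: (irr_sorted_eq (@tr m) (@irr m)). Qed.

Lemma sorted_pair m l a b : sorted (lt m) l -> a \in l -> b \in l ->
  lt m a b = (index a l < index b l)%N.
Proof.
move=> sl al bl; have ul := sorted_uniq_lt sl.
have sub c d : c \in l -> d \in l -> (index c l < index d l)%N -> lt m c d.
  by move=> cl dl; apply: sorted_ltn_index.
apply/idP/idP => [ab|]; last exact: sub.
rewrite ltnNge leq_eqVlt; apply/negP => /orP[/eqP ba|/(sub _ _ bl al) ba].
  have ab' : b = a by rewrite -(nth_index a bl) ba nth_index.
  by move: ab; rewrite ab' irr.
by have := irr m a; rewrite (tr ab ba).
Qed.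

Lemma sorted_eq_cyl m n l : sorted (lt m) l -> sorted (lt n) l ->
  {in l &, lt m =2 lt n}.
Proof. by move=> sm sn a b al bl; rewrite (sorted_pair sm)// (sorted_pair sn). Qed.

Lemma sorted_sub m n s l : {in s &, lt m =2 lt n} -> {subset l <= s} ->
  sorted (lt m) l = sorted (lt n) l.
Proof.
by move=> mn ls; apply: (@eq_in_sorted _ (mem s)) => //; exact/allP.
Qed.

Lemma cyl_act g m l : G g -> cyl (map g l) (act g m) = cyl l m.
Proof.
move=> Gg; rewrite /cyl /= sorted_map; congr is_true; apply: eq_sorted => a b /=.
by rewrite /relpre /= (go_act O).
Qed.

Lemma sorted_map_in m n g l :
  (forall a b, a \in l -> b \in l -> lt m a b = lt n (g a) (g b)) ->
  sorted (lt n) (map g l) = sorted (lt m) l.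
Proof.
move=> gP; rewrite sorted_map; apply: (@eq_in_sorted _ (mem l)); last exact/allP.
by move=> a b al bl; rewrite /= gP.
Qed.

(** The conjugating map is increasing, and a finite linear order has a single increasing
    enumeration, so the lists match entry by entry. *)
Lemma cyl_transport m n l k : l =i k -> cyl l m -> cyl k n ->
  exists2 g, G g & map g l = k.
Proof.
move=> lk sl sk; have [h Gh [hl hP]] := go_sim O l m n.
exists h => //; apply: (@sorted_eq_lt n) => //; first by move=> x; rewrite hl.
by rewrite (sorted_map_in hP).
Qed.

(** Finite linear orders are rigid. *)
Lemma sorted_fix m s g : G g -> map g s =i s ->
  (forall a b, a \in s -> b \in s -> lt m a b = lt m (g a) (g b)) ->
  {in s, g =1 id}.
Proof.
move=> Gg gs gP; have [l sl ls] := exists_sorted m s.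
suff gl : map g l = map id l.
  by move=> a; rewrite -ls => al; exact: (eq_in_map _ _ _).2 gl _ al.
rewrite map_id; apply: (@sorted_eq_lt m) => //.
  by move=> x; rewrite (eq_mem_map _ ls) gs ls.
rewrite (@sorted_map_in m)// => a b; rewrite !ls; exact: gP.
Qed.

Lemma cyl_small l : (size l <= 1)%N -> cyl l = setT.
Proof. by case: l => [|a []]// _; apply/seteqP; split. Qed.

Lemma cyl_cons a b l : cyl [:: a, b & l] = [set m | lt m a b] `&` cyl (b :: l).
Proof. by apply/seteqP; split=> m /=; rewrite /cyl /= => /andP. Qed.

Lemma cyl_open l : open (cyl l).
Proof.
elim: l => [|a [|b l] IHl]; [by rewrite cyl_small//; exact: openT..|].
by rewrite cyl_cons; apply: openI => //; exact: go_open O _ _.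
Qed.

Lemma lt_closed a b : closed [set m | lt m a b].
Proof.
have [->|ab] := eqVneq a b.
  rewrite (_ : mkset _ = set0); first exact: closed0.
  by apply/seteqP; split=> m //=; rewrite irr.
rewrite (_ : mkset _ = ~` [set m | lt m b a]).
  by apply/open_closedC; exact: go_open O _ _.
apply/seteqP; split=> m /= mab.
  by move=> mba; have := irr m a; rewrite (tr mab mba).
by have := go_tot O m ab; case: (lt m a b) => //= /mab.
Qed.

Lemma cyl_closed l : closed (cyl l).
Proof.
elim: l => [|a [|b l] IHl]; [by rewrite cyl_small//; exact: closedT..|].
by rewrite cyl_cons; apply: closedI => //; exact: lt_closed.
Qed.

Lemma eq_lt_cyl n s : exists2 l, cyl l n &
  forall m, (forall a b, a \in s -> b \in s -> lt m a b = lt n a b) <-> cyl l m.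
Proof.
have [l sl ls] := exists_sorted n s; exists l => // m; split=> [mn|sm a b].
  have ls' : {subset l <= s} by move=> x; rewrite ls.
  by rewrite /cyl /= (sorted_sub mn ls').
by rewrite -!ls => al bl; exact: (sorted_eq_cyl sm sl al bl).
Qed.

End Orders.

(** * Injectivity of the order map *)

Section MinimalFlow.
Variables (T : countType) (G : permgroup T) (M : ptopologicalType).
Variables (act : (T -> T) -> M -> M).
Hypothesis Mmin : gminimal G act.
Implicit Types (m n : M) (a b : T) (l k s : seq T) (g h : T -> T).

Lemma gflow_of_min : gflow G act. Proof. by case: Mmin. Qed.

Lemma flow_compact : compact [set: M]. Proof. by case: gflow_of_min. Qed.

Lemma flow_act1 m : act id m = m. Proof. by case: gflow_of_min. Qed.

Lemma flow_actM g h m : G g -> G h -> act (g \o h) m = act g (act h m).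
Proof. by case: gflow_of_min => _ _ _ aM _; exact: aM. Qed.

Lemma flow_actK g : G g -> cancel (act g) (act (ginv g)).
Proof.
by move=> Gg m; rewrite -flow_actM ?(comp_can Gg) ?flow_act1//; exact: ginv_in.
Qed.

Lemma flow_act_continuous g : G g -> continuous (act g).
Proof.
move=> Gg m U nU; have [_ _ _ _ /(_ g m U Gg nU)[s [V [nV VP]]]] := gflow_of_min.
by rewrite nbhs_simpl; apply: filterS nV => n Vn /=; exact: VP.
Qed.

Lemma minimal_closed (A : set M) m : closed A ->
  (forall g n, G g -> A n -> A (act g n)) -> A m -> A = setT.
Proof.
move=> Acl Ainv Am; case: Mmin => _ _ /(_ A Acl Ainv)[A0|//].
by move: Am; rewrite A0.
Qed.

Lemma orbit_meets_open m (U : set M) : open U -> U !=set0 ->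
  exists2 g, G g & U (act g m).
Proof.
move=> oU [n Un]; apply: contrapT => nex.
pose A := [set n | forall g, G g -> ~ U (act g n)].
suff : A = setT.
  by move/seteqP => [_ /(_ n Logic.I) /(_ _ (pg1 G))]; rewrite flow_act1.
apply: (@minimal_closed _ m).
- have -> : A = \bigcap_(g in [set g | G g]) act g @^-1` (~` U).
    by apply/seteqP; split=> x /= xP g Gg; exact: xP.
  apply: closed_bigI => g Gg; apply: preimage_closed; last exact: open_closedC.
  by move=> ? _; exact: flow_act_continuous.
- by move=> g x Gg Ax h Gh; rewrite -flow_actM//; apply: Ax; exact: pgM.
- by move=> g Gg Ug; apply: nex; exists g.
Qed.

Variable lt : M -> rel T.
Hypothesis O : gorder G act lt.
Hypothesis ram : ramsey_group G.

(* The base point ranges over [M] itself: colouring each copy of [s] by the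
   position of the flow point in the frame where the copy carries the order
   pattern of [n], Ramsey makes the answer depend on the order pattern only. *)
Lemma order_dichotomy s n (V C : set M) : open V -> closed C ->
  (forall h m, G h -> {in s, h =1 id} -> V m -> C (act h m)) ->
  (forall m, (forall a b, a \in s -> b \in s -> lt m a b = lt n a b) -> C m) \/
  (forall m, (forall a b, a \in s -> b \in s -> lt m a b = lt n a b) -> ~ V m).
Proof.
move=> oV cC VC.
pose P : set M :=
  [set m | forall a b, a \in s -> b \in s -> lt m a b = lt n a b].
have [l _ lP] := eq_lt_cyl O n s.
have PE : P = cyl lt l by apply/seteqP; split=> m /lP.
pose F (i : unit) (b : bool) : set M := ~` P `|` (if b then C else ~` V).
have Fcl i (b : bool) : closed (F i b).
  apply: closedU; first by rewrite PE; apply/open_closedC/(cyl_open O).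
  by case: b => //; exact: open_closedC.
(* A copy is coloured [true] when some frame on it shows the pattern of [n] and puts the base point
   into [V]. Every frame on it with this pattern then puts the point into [C], since two such frames
   differ by an element fixing [s] pointwise. *)
pose chi (i : unit) (S : set T) : bool := `[< exists2 g, G g &
  [/\ [set` map (ginv g) s] = S, P (act g point) & V (act g point)] >].
have [y yP] : exists y, forall i, exists b : bool, forall g, G g -> F i b (act g y).
  apply: (ramsey_flow ram flow_compact flow_actM flow_act_continuous
    (y0 := point) (s := fun=> s) (chi := chi) Fcl).
  move=> i g Gg; have [Pg|] := pselect (P (act g point)); [right|by left].
  rewrite /chi; case: asboolP => [|nV /=]; last first.
    by move=> Vg; apply: nV; exists g.
  move=> [h Gh [/set_seq_eq hg Ph Vh]].
  have Ghg : G (g \o ginv h) by apply: pgM => //; exact: ginv_in.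
  have -> : act g point = act (g \o ginv h) (act h point).
    by rewrite (flow_actM _ Gg (ginv_in Gh)) (flow_actK Gh).
  apply: VC => //; apply: (sorted_fix O (m := n)) => //.
    move=> x; rewrite map_comp (eq_mem_map _ hg) -map_comp.
    by rewrite (eq_map (g := id)) ?map_id// => z /=; rewrite (Kginv Gg).
  have hgs a : a \in s -> g (ginv h a) \in s.
    move=> sa; have : ginv h a \in map (ginv h) s by exact: map_f.
    by rewrite hg => /mapP[c sc ->]; rewrite (Kginv Gg).
  move=> a b sa sb; rewrite /= -(Pg _ _ (hgs _ sa) (hgs _ sb)) (go_act O)//.
  by rewrite -(Ph _ _ sa sb) -{1}(Kginv Gh a) -{1}(Kginv Gh b) (go_act O).
have [b bP] := yP tt.
(* The condition is closed and holds along the orbit of [y]; minimality spreads it to every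
   point. *)
have all_F m : F tt b m.
  pose A := [set m | forall g, G g -> F tt b (act g m)].
  suff : A = setT.
    by move/seteqP => [_ /(_ m Logic.I) /(_ _ (pg1 G))]; rewrite flow_act1.
  apply: (@minimal_closed _ y) => //.
    have -> : A = \bigcap_(g in [set g | G g]) act g @^-1` (F tt b).
      by apply/seteqP; split=> x /= xP g Gg; exact: xP.
    apply: closed_bigI => g Gg; apply: preimage_closed => // ? _.
    exact: flow_act_continuous.
  by move=> g x Gg Ax h Gh; rewrite -flow_actM//; apply: Ax; exact: pgM.
by case: b {bP} all_F => all_F; [left|right] => m Pm; case: (all_F m) => // /(_ Pm).
Qed.

(** Separate [m] and [n] by open sets. By continuity at the identity, elements fixing a suitable
    finite [s] keep a neighbourhood of [m] away from that of [n]. As [m] shares the pattern of [n]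
    on [s], both cases of the dichotomy are contradictory. *)
Lemma order_inj m n : lt m =2 lt n -> m = n.
Proof.
move=> mn; apply: contrapT => /eqP mNn.
have [_ + _ _ cont] := gflow_of_min; rewrite open_hausdorff => Mh.
have [[U1 U2] /= [/set_mem U1m /set_mem U2n] [oU1 oU2 U12]] := Mh _ _ mNn.
have U1C : nbhs (act id m) (~` U2).
  rewrite flow_act1; apply: filterS (open_nbhs_nbhs (conj oU1 U1m)) => x U1x U2x.
  suff : (U1 `&` U2) x by rewrite (eqP U12).
  by [].
have [s [V [nV VP]]] := cont id m _ (pg1 G) U1C.
have [||all_C|all_V] := @order_dichotomy s n V^° (~` U2) (open_interior V).
- exact: open_closedC.
- move=> h x Gh hs /interior_subset; exact: VP.
- by apply: (all_C n).
- by apply: (all_V m).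
Qed.

(** By injectivity [m] is the only common point of its cylinders, and compactness turns this into a
    base. *)
Lemma order_base m (U : set M) : nbhs m U -> exists2 l, cyl lt l m & cyl lt l `<=` U.
Proof.
move=> nU.
pose B s : set M := [set n | forall a b, a \in s -> b \in s -> lt n a b = lt m a b].
have [|||s sU] := @compact_base M T B m U flow_compact _ _ _ nU.
- move=> s; have [l _ lP] := eq_lt_cyl O m s.
  have -> : B s = cyl lt l by apply/seteqP; split=> n /lP.
  exact: cyl_closed O l.
- by move=> s t st n Bn a b /st sa /st sb; exact: Bn.
- move=> n Bn; apply: order_inj => a b.
  by apply: (Bn [:: a; b]); rewrite !inE eqxx ?orbT.
- have [l lm lP] := eq_lt_cyl O m s; exists l => // n /lP Bn; exact: sU.
Qed.

End MinimalFlow.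

(** * Generic points *)

Section Generic.
Variables (T : countType) (G : permgroup T) (M : ptopologicalType).
Variables (act : (T -> T) -> M -> M) (lt : M -> rel T).
Hypothesis Mmin : gminimal G act.
Hypothesis O : gorder G act lt.
Hypothesis ram : ramsey_group G.
Hypothesis Gclosed : forall f : T -> T, bijective f ->
  (forall s : seq T, exists2 h, G h & {in s, h =1 f}) -> G f.
Implicit Types (m n : M) (a b : T) (l k s : seq T) (g h : T -> T).

(** One-point extension property: a position of [b] over the list that occurs somewhere in the flow
    is taken at [m] by some conjugate of [b] over the list. *)
Definition extends l1 b l2 : set M := [set m |
  cyl lt (l1 ++ l2) m -> cyl lt (l1 ++ b :: l2) !=set0 ->
  exists2 g, G g & {in l1 ++ l2, g =1 id} /\ cyl lt (l1 ++ g b :: l2) m].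

Definition generic : set M := [set m | forall l1 b l2, extends l1 b l2 m].

Lemma extends_open l1 b l2 : open (extends l1 b l2).
Proof.
have [ne|empty] := pselect (cyl lt (l1 ++ b :: l2) !=set0); last first.
  rewrite (_ : extends _ _ _ = setT); first exact: openT.
  by apply/seteqP; split=> m // _ _ /empty.
rewrite (_ : extends _ _ _ = ~` cyl lt (l1 ++ l2) `|`
  \bigcup_(g in [set g | G g /\ {in l1 ++ l2, g =1 id}])
    cyl lt (l1 ++ g b :: l2)).
  apply: openU; first exact/closed_openC/(cyl_closed O).
  by apply: bigcup_open => g _; exact: cyl_open O _.
apply/seteqP; split=> m /=.
  move=> mP; have [ml|] := pselect (cyl lt (l1 ++ l2) m); last by left.
  by right; have [g Gg [gf gm]] := mP ml ne; exists g.
by case=> [nm /nm//|[g [Gg gf] gm]] _ _; exists g.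
Qed.

Lemma generic_bigcap : generic = \bigcap_(i in [set: nat])
  (if unpickle i is Some p then extends p.1.1 p.1.2 p.2 else setT).
Proof.
apply/seteqP; split=> m mP /=.
  by move=> n _; case: unpickle => // -[[l1 b] l2]; exact: mP.
by move=> l1 b l2; have := mP (pickle (l1, b, l2)) Logic.I; rewrite pickleK.
Qed.

Lemma generic_G_delta : G_delta generic.
Proof.
exists (fun i : nat => if unpickle i is Some p then extends p.1.1 p.1.2 p.2 else setT).
split; last exact: generic_bigcap.
by move=> i; case: unpickle => [p|]; [exact: extends_open|exact: openT].
Qed.

Lemma generic_act g m : G g -> generic m -> generic (act g m).
Proof.
move=> Gg gm l1 b l2.
have lE l : l = map g (map (ginv g) l).
  by rewrite -map_comp (eq_map (g := id)) ?map_id// => x /=; rewrite (Kginv Gg).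
have cE l : cyl lt l (act g m) = cyl lt (map (ginv g) l) m.
  by rewrite {1}(lE l) (cyl_act O).
move=> + [n nl]; rewrite cE map_cat => ml.
have [|h Gh [hf hm]] := gm (map (ginv g) l1) (ginv g b) (map (ginv g) l2) ml.
  exists (act (ginv g) n); rewrite -map_cons -map_cat (cyl_act O)//.
  exact: ginv_in.
exists (g \o (h \o ginv g)).
  by apply: pgM => //; apply: pgM => //; exact: ginv_in.
split; last by rewrite cE map_cat /= (ginvK Gg).
by move=> x xl /=; rewrite hf ?(Kginv Gg)// -map_cat map_f.
Qed.

(** A finite stage of the back and forth: a list increasing at [m], with a group element making it
    increasing at [n]. *)
Let ok m n (p : seq T * (T -> T)) :=
  [/\ G p.2, cyl lt p.1 m & cyl lt (map p.2 p.1) n].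

Let ext (p q : seq T * (T -> T)) := {subset p.1 <= q.1} /\ {in p.1, q.2 =1 p.2}.

Let ext_trans p q r : ext p q -> ext q r -> ext p r.
Proof.
by move=> [pq gpq] [qr gqr]; split=> [x /pq/qr//|x px]; rewrite gqr ?gpq ?pq.
Qed.

(** Insert [a] where [m] puts it. The image position occurs at [act g m], so genericity of [n]
    corrects [g] by an element fixing the old image list. *)
Lemma extend_forth m n p a : generic n -> ok m n p ->
  exists q, [/\ ok m n q, ext p q & a \in q.1].
Proof.
case: p => l g gn [/= Gg ml nl].
have [al|al] := boolP (a \in l); first by exists (l, g); split=> //; split.
have [k1 [k2 [lE mk]]] := sorted_insert O al ml.
have [||h Gh [hf hn]] := gn (map g k1) (g a) (map g k2).
- by rewrite -map_cat -lE.
- by exists (act g m); rewrite -map_cons -map_cat (cyl_act O).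
have hg : {in l, h \o g =1 g}.
  by move=> x xl /=; rewrite hf// -map_cat -lE map_f.
exists (k1 ++ a :: k2, h \o g); split; last by rewrite mem_cat mem_head orbT.
  split=> //=; first exact: pgM.
  rewrite map_cat /=; have := hn.
  have mapE k : {subset k <= l} -> map (h \o g) k = map g k.
    by move=> kl; apply/eq_in_map => x /kl; exact: hg.
  by rewrite !mapE// => x xk; rewrite lE mem_cat xk ?orbT.
split=> //= x; rewrite lE mem_cat mem_cat inE => /orP[] ->//; by rewrite !orbT.
Qed.

Lemma extend_back m n p a : generic m -> ok m n p ->
  exists q, [/\ ok m n q, ext p q & a \in map q.2 q.1].
Proof.
case: p => l g gm [/= Gg ml nl].
have glK : map (ginv g) (map g l) = l.
  by rewrite -map_comp (comp_can Gg) map_id.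
have okV : ok n m (map g l, ginv g).
  by split=> /=; [exact: ginv_in| |rewrite glK].
have [[k h] [[/= Gh nk mk] [/= sub hV] ak]] := extend_forth a gm okV.
have hkK : map (ginv h) (map h k) = k.
  by rewrite -map_comp (comp_can Gh) map_id.
exists (map h k, ginv h); split=> /=; rewrite ?hkK//.
  by split=> //=; [exact: ginv_in|rewrite hkK].
have hg x : x \in l -> h (g x) = x by move=> xl; rewrite hV ?map_f ?(ginvK Gg).
split=> /= x xl; last by rewrite -{1}(hg x xl) (ginvK Gh).
by rewrite -(hg x xl) map_f// sub// map_f.
Qed.

Lemma generic_orbit m n : generic m -> generic n -> exists2 g, G g & n = act g m.
Proof.
move=> gm gn.
have step (p : {p | ok m n p}) (a : T) : {q : {p | ok m n p} |
    [/\ ext (sval p) (sval q), a \in (sval q).1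
      & a \in map (sval q).2 (sval q).1]}.
  apply: cid; case: p => p okp /=.
  have [q [okq pq aq]] := extend_forth a gn okp.
  have [r [okr qr ar]] := extend_back a gm okq.
  exists (exist _ r okr); split=> //=; first exact: ext_trans qr.
  by case: qr => + _; apply.
have ok0 : ok m n ([::], id) by split=> //; exact: pg1.
(* Round [j] treats the point with code [j], both as an argument and as a value of the map. *)
pose st := fix st i : {p | ok m n p} := if i is j.+1 then
  (if unpickle j is Some a then sval (step (st j) a) else st j)
  else exist _ _ ok0.
pose l i := (sval (st i)).1; pose g i := (sval (st i)).2.
have okst i : ok m n (l i, g i).
  by rewrite /l /g -surjective_pairing; exact: (svalP (st i)).
have st_ext i j : (i <= j)%N -> ext (l i, g i) (l j, g j).
  have ext_refl p : ext p p by split.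
  rewrite /l /g -!surjective_pairing; elim: j => [|j IHj].
    by rewrite leqn0 => /eqP ->.
  rewrite leq_eqVlt => /predU1P[->|/IHj ij]; first exact: ext_refl.
  apply: ext_trans ij _; rewrite /=; case: unpickle => [a|]; last exact: ext_refl.
  by have [] := svalP (step (st j) a).
have lpickle a : a \in l (pickle a).+1 /\
    a \in map (g (pickle a).+1) (l (pickle a).+1).
  by rewrite /l /g /= pickleK; have [] := svalP (step (st (pickle a)) a).
pose f a := g (pickle a).+1 a.
have fg i a : a \in l i -> f a = g i a.
  move=> ai; have [aN _] := lpickle a.
  have [iN|/ltnW iN] := leqP i (pickle a).+1; have [_ /= e] := st_ext _ _ iN.
    by rewrite /f e.
  by rewrite /f -e.
have cover s : exists i, {subset s <= l i}.
  elim: s => [|a s [i si]]; first by exists 0%N.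
  exists (maxn i (pickle a).+1) => x; rewrite inE => /predU1P[->|/si xi].
    by have [+ _] := st_ext _ _ (leq_maxr i (pickle a).+1); apply; case: (lpickle a).
  by have [+ _] := st_ext _ _ (leq_maxl i (pickle a).+1); apply.
have finj : injective f.
  move=> a b; have [i si] := cover [:: a; b].
  rewrite !(fg i) ?si ?inE ?eqxx ?orbT//.
  by have [Gi _ _] := okst i; exact: (G_inj Gi).
have fsurj b : {a | f a = b}.
  apply: cid; have [_ /mapP[a al ->]] := lpickle b.
  by exists a; rewrite (fg _ _ al).
(* On each finite set [f] agrees with some stage, and [G] is closed. *)
have Gf : G f.
  apply: Gclosed.
    exists (fun b => sval (fsurj b)) => x; last exact: svalP (fsurj x).
    by apply: finj; exact: svalP (fsurj (f x)).
  move=> s; have [i si] := cover s; exists (g i); first by case: (okst i).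
  by move=> a /si ai; rewrite (fg i).
(* Points are determined by their orders, and one stage decides the order of any given pair. *)
exists f => //; apply: (order_inj Mmin O ram) => a b.
rewrite -{2}(Kginv Gf a) -{2}(Kginv Gf b) (go_act O)//.
move: (ginv f a) (ginv f b) (Kginv Gf a) (Kginv Gf b) => c d <- <-.
have [i si] := cover [:: c; d]; have [Gi mi ni] := okst i.
have ci : c \in l i by apply: si; rewrite inE eqxx.
have di : d \in l i by apply: si; rewrite !inE eqxx orbT.
rewrite !(fg i)// (sorted_pair O ni) ?map_f// (sorted_pair O mi)//.
by rewrite !index_map//; exact: (G_inj Gi).
Qed.

(** Baire category argument with nested nonempty cylinders inside [U i] and [V i]; they are closed,
    so compactness gives a common point. *)
Lemma dense_G_delta_meet (A B : set M) :
  dense A -> G_delta A -> dense B -> G_delta B -> A `&` B !=set0.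
Proof.
move=> dA [U [oU AE]] dB [V [oV BE]].
have dU i : dense (U i).
  move=> W W0 oW; have [x [Wx Ax]] := dA W W0 oW.
  by exists x; split=> //; rewrite AE in Ax; exact: Ax.
have dV i : dense (V i).
  move=> W W0 oW; have [x [Wx Bx]] := dB W W0 oW.
  by exists x; split=> //; rewrite BE in Bx; exact: Bx.
have step (p : {l | cyl lt l !=set0}) (i : nat) : {q : {l | cyl lt l !=set0} |
    cyl lt (sval q) `<=` cyl lt (sval p) `&` (U i `&` V i)}.
  apply: cid; case: p => l l0 /=.
  have [x [lx Ux]] := dU i _ l0 (cyl_open O l).
  have [|y [[ly Uy] Vy]] := dV i (cyl lt l `&` U i) _ (openI (cyl_open O l) (oU i)).
    by exists x.
  have [|k ky kP] := order_base Mmin O ram (m := y) (U := cyl lt l `&` (U i `&` V i)).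
    apply: open_nbhs_nbhs; split=> //.
    by apply: openI; [exact: cyl_open O l|exact: openI].
  by exists (exist (fun l => cyl lt l !=set0) k (ex_intro _ y ky)).
have l0 : cyl lt [::] !=set0 by exists point.
pose st := fix st i : {l | cyl lt l !=set0} :=
  if i is j.+1 then sval (step (st j) j) else exist (fun l => cyl lt l !=set0) [::] l0.
have st_mono i j : (i <= j)%N -> cyl lt (sval (st j)) `<=` cyl lt (sval (st i)).
  elim: j => [|j IHj]; first by rewrite leqn0 => /eqP ->.
  rewrite leq_eqVlt => /predU1P[->//|/IHj ij].
  by move=> x /(svalP (step (st j) j))[/ij].
have [z zP] : \bigcap_(i in [set: nat]) cyl lt (sval (st i)) !=set0.
  move: (flow_compact Mmin).
  rewrite compact_In0 => /(_ _ setT (fun i => cyl lt (sval (st i)))); apply.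
    exists (fun i => cyl lt (sval (st i))); last by move=> i _; rewrite setTI.
    by move=> i _; exact: cyl_closed O _.
  move=> D' _; have [x xP] := svalP (st (\max_(i <- finmap.enum_fset D') i)).
  by exists x => i /= iD'; apply: st_mono xP; apply: leq_bigmax_seq.
exists z; split; rewrite ?AE ?BE => i _;
  by have /(svalP (step (st i) i))[_ []] := zP i.+1 Logic.I.
Qed.

End Generic.

(** * Invariant measures *)

Section Measures.
Variables (T : countType) (G : permgroup T) (M : ptopologicalType) (R : realType).
Variables (act : (T -> T) -> M -> M) (lt : M -> rel T).
Hypothesis O : gorder G act lt.
Implicit Types (m n : M) (a b : T) (l k s : seq T) (g h : T -> T).
Implicit Types (mu nu : probability (borel M) R).

Definition ginvariant mu := forall g (A : set (borel M)), G g -> measurable A ->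
  mu (act g @^-1` A) = mu A.

Lemma open_borel (U : set M) : open U -> measurable (U : set (borel M)).
Proof. by move=> oU; apply: sub_sigma_algebra. Qed.

Lemma closed_borel (U : set M) : closed U -> measurable (U : set (borel M)).
Proof.
move=> cU; rewrite -[U]setCK; apply: measurableC; apply: open_borel.
exact: closed_openC.
Qed.

Lemma cyl_borel l : measurable (cyl lt l : set (borel M)).
Proof. by apply: open_borel; exact: cyl_open O l. Qed.

Lemma mu_cyl_map mu g l : ginvariant mu -> G g ->
  mu (cyl lt (map g l)) = mu (cyl lt l).
Proof.
move=> imu Gg; rewrite -(imu g (cyl lt (map g l)) Gg (cyl_borel _)).
congr (mu _); apply/seteqP; split=> m; rewrite /preimage /=;
  by have := @cyl_act _ _ _ _ _ O g m l Gg; rewrite /cyl /= => ->.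
Qed.

Lemma cyl_disjoint s : trivIset [set l | uniq l /\ l =i s] (cyl lt).
Proof.
move=> l k [_ ls] [_ ks] [m [ml mk]].
by apply: (sorted_eq_lt O _ ml mk) => x; rewrite ls ks.
Qed.

(** Indices of a finite clopen partition of the flow, whose classes are the order patterns occurring
    on [s]. *)
Definition cells s : set (seq T) := [set l | l =i s /\ cyl lt l !=set0].

Lemma cells_uniq s l : cells s l -> uniq l /\ l =i s.
Proof. by move=> [ls [m ml]]; split=> //; exact: sorted_uniq_lt O _ _ ml. Qed.

Lemma cells_finite s : finite_set (cells s).
Proof.
apply: (@sub_finite_set _ _ [set` permutations (undup s)]); last exact: finite_seq.
move=> l /cells_uniq[ul ls] /=; rewrite mem_permutations.
by apply: uniq_perm => //; [exact: undup_uniq|move=> x; rewrite ls mem_undup].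
Qed.

Definition ncells s := size (finmap.enum_fset (fset_set (cells s))).

Lemma cells_trivIset s (D : set (seq T)) : D `<=` cells s -> trivIset D (cyl lt).
Proof.
by move=> Ds; apply: sub_trivIset (cyl_disjoint (s := s)) => l /Ds /cells_uniq.
Qed.

Lemma cells_cover s m : exists2 l, cells s l & cyl lt l m.
Proof.
have [l sl ls] := exists_sorted O m s; exists l => //; split=> //.
by exists m.
Qed.

Lemma mu_cells mu s (D : set (seq T)) : D `<=` cells s ->
  mu (\bigcup_(l in D) cyl lt l) = (\sum_(l \in D) mu (cyl lt l))%E.
Proof.
move=> Ds; apply: measure_fin_bigcup.
- by apply: sub_finite_set Ds _; exact: cells_finite.
- exact: cells_trivIset Ds.
- by move=> l _; exact: cyl_borel.
Qed.

Lemma mu_cell_eq mu s l k : ginvariant mu -> cells s l -> cells s k ->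
  mu (cyl lt l) = mu (cyl lt k).
Proof.
move=> imu [ls [m ml]] [ks [n nk]].
have [|g Gg <-] := cyl_transport O (k := k) _ ml nk.
  by move=> x; rewrite ls ks.
by rewrite mu_cyl_map.
Qed.

(** Cells over [s] are conjugate, hence of equal measure, and they partition the space: the common
    value does not depend on [mu]. *)
Lemma mu_cell mu s l : ginvariant mu -> cells s l ->
  (fine (mu (cyl lt l)) *+ ncells s = 1)%R.
Proof.
move=> imu sl; apply: EFin_inj; rewrite -(probability_setT mu).
have -> : [set: borel M] = \bigcup_(k in cells s) cyl lt k.
  by apply/seteqP; split=> m // _; have [k] := cells_cover s m; exists k.
rewrite (mu_cells _ (@subset_refl _ (cells s))) (eq_fsbigr (fun=> (fine (mu (cyl lt l)))%:E)).
  rewrite (fsbig_finite _ _ (cells_finite s)) /= sumEFin.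
  by congr EFin; rewrite big_const_seq count_predT iter_addr_0.
move=> k; rewrite inE => sk; rewrite (mu_cell_eq imu sl sk).
by rewrite fineK//; apply: fin_num_measure; exact: cyl_borel.
Qed.

Lemma mu_cyl_gt0 mu l : ginvariant mu -> cyl lt l !=set0 -> (0 < fine (mu (cyl lt l)))%R.
Proof.
move=> imu l0; have /mu_cell := conj (fun x => erefl (x \in l)) l0.
move=> /(_ mu imu) mul; rewrite lt_neqAle fine_ge0// andbT eq_sym.
by apply: contra_eq_neq mul => ->; rewrite mul0rn eq_sym oner_eq0.
Qed.

Lemma mu_nu_cyl mu nu l : ginvariant mu -> ginvariant nu ->
  mu (cyl lt l) = nu (cyl lt l).
Proof.
move=> imu inu; have [l0|] := pselect (cyl lt l !=set0); last first.
  by move=> /set0P/negP; rewrite negbK => /eqP ->; rewrite !measure0.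
have sl : cells l l by [].
have := mu_cell imu sl; rewrite -(mu_cell inu sl) => /eqP.
rewrite -[X in X == _]mulr_natr -[X in _ == X]mulr_natr.
have N0 : ((ncells l)%:R != 0 :> R)%R.
  apply/eqP => N0; have := mu_cell imu sl; rewrite -mulr_natr N0 mulr0.
  by move=> /esym/eqP; rewrite oner_eq0.
rewrite (can_eq (mulfK N0)) => /eqP mn.
by rewrite -[LHS]fineK ?mn ?fineK//; apply: fin_num_measure; exact: cyl_borel.
Qed.

Hypothesis Mmin : gminimal G act.
Hypothesis ram : ramsey_group G.

(** [U] is the increasing union of the sets [V i], each a finite union of cells over the points of
    code below [i]; the measures agree on every [V i]. *)
Lemma mu_nu_open mu nu (U : set M) : ginvariant mu -> ginvariant nu -> open U ->
  mu U = nu U.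
Proof.
move=> imu inu oU.
pose sn i : seq T := pmap unpickle (iota 0 i).
pose D i : set (seq T) := [set l | cells (sn i) l /\ cyl lt l `<=` U].
pose V i : set (borel M) := \bigcup_(l in D i) cyl lt l.
have Dcells i : D i `<=` cells (sn i) by move=> l [].
have mV i : measurable (V i).
  by apply: open_borel; apply: bigcup_open => l _; exact: cyl_open O l.
have Vmono : {homo V : i j / (i <= j)%N >-> (i <= j)%O}.
  move=> i j ij; apply/subsetPset => m [l [[ls l0] lU] ml].
  have [k [ks k0] mk] := cells_cover (sn j) m; exists k => //; split=> // n nk.
  apply: lU; rewrite /cyl /= -(@sorted_sub _ _ lt m n k)//.
    by apply: (sorted_eq_cyl O mk nk).
  move=> x; rewrite ls ks !mem_pmap => /mapP[y yi ->]; apply: map_f.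
  by move: yi; rewrite !mem_iota /= !add0n => /leq_trans; apply.
have UE : U = \bigcup_i V i.
  apply/seteqP; split=> m; last by move=> [i _ [l [_ lU] ml]]; exact: lU.
  move=> Um; have [k mk kU] := order_base Mmin O ram (open_nbhs_nbhs (conj oU Um)).
  pose i := (\max_(a <- k) pickle a).+1.
  have ksn : {subset k <= sn i}.
    move=> x xk; rewrite mem_pmap; apply/mapP; exists (pickle x); last by rewrite pickleK.
    by rewrite mem_iota /= add0n ltnS; apply: (leq_bigmax_seq _ xk).
  have [l [ls l0] ml] := cells_cover (sn i) m.
  exists i => //; exists l => //; split=> // n nl; apply: kU.
  rewrite /cyl /= -(@sorted_sub _ _ lt m n l)//; first exact: (sorted_eq_cyl O ml nl).
  by move=> x /ksn; rewrite ls.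
have mUV : measurable (\bigcup_i V i) by exact: bigcup_measurable.
have mucvg := nondecreasing_cvg_mu mV mUV Vmono (mu := mu).
have nucvg := nondecreasing_cvg_mu mV mUV Vmono (mu := nu).
rewrite UE; apply: (cvg_unique _ mucvg) => //.
suff -> : mu \o V = nu \o V by [].
apply/funext => i /=; rewrite /V !(mu_cells _ (Dcells i)).
by apply: eq_fsbigr => l _; exact: mu_nu_cyl.
Qed.

Lemma mu_nu_unique mu nu (A : set (borel M)) : ginvariant mu -> ginvariant nu ->
  measurable A -> mu A = nu A.
Proof.
move=> imu inu.
apply: (@measure_unique _ R (borel M) (@open M) (fun=> setT) erefl) => //.
- by move=> U V oU oV; exact: openI.
- by move=> _; exact: openT.
- by rewrite bigcup_const//; exists 0%N.
- by move=> U oU; exact: mu_nu_open.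
- by move=> _; rewrite /= probability_setT ltry.
Qed.

Local Open Scope ring_scope.

(** Integrate the number of events containing a point: if it never exceeded [k], the sum of the
    measures would be at most [k]. *)
Lemma overlap mu (I : eqType) (l : seq I) (Q : I -> set (borel M)) (p : R) (k : nat) :
  (forall i, i \in l -> measurable (Q i) /\ mu (Q i) = p%:E) ->
  k%:R < p *+ size l -> exists m, (k < count (fun i => m \in Q i) l)%N.
Proof.
move=> QP kp; apply: contrapT => /forallNP nk.
have mQ i : measurable (if i \in l then Q i else set0).
  by case: ifP => // /QP[].
pose f i (x : borel M) : \bar R := (\1_(if i \in l then Q i else set0) x)%:E.
have : (\int[mu]_x (\sum_(i <- l) f i x) <= \int[mu]_x (k%:R)%:E)%E.
  apply: ge0_le_integral => //.
  - by move=> x _; apply: sume_ge0 => i _; rewrite lee_fin.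
  - apply: emeasurable_sum => i; apply/measurable_EFinP.
    exact: measurable_indic.
  - move=> x _; rewrite sumEFin lee_fin.
    have := nk x; move/negP; rewrite -leqNgt -(ler_nat R) => ck; apply: le_trans ck.
    rewrite -sum1_count natr_sum [X in _ <= X]big_mkcond /= big_seq [X in _ <= X]big_seq.
    apply: ler_sum => i il; rewrite il indicE.
    by case: ifP => _.
rewrite ge0_integral_sum//; last 2 first.
- by move=> i; apply/measurable_EFinP; exact: measurable_indic.
- by move=> i x _; rewrite lee_fin.
have -> : (\int[mu]_x (k%:R)%:E = (k%:R)%:E :> \bar R)%E.
  rewrite integral_cst// -[RHS]mule1.
  by congr (_ * _)%E; exact: (probability_setT mu).
rewrite big_seq.
rewrite (eq_bigr (fun=> p%:E)); last first.
  move=> i il; rewrite integral_indic// setIT il.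
  by have [_] := QP i il.
by rewrite -big_seq sumEFin lee_fin big_const_seq count_predT iter_addr_0 leNgt kp.
Qed.

End Measures.

(** * Unrealised positions are negligible *)

Lemma greedy_coloring (V : countType) (nb : V -> seq V) (E : V -> V -> Prop) (N : nat) :
  (forall v, (size (nb v) <= N)%N) ->
  (forall u v, E u v -> u \in nb v /\ v \in nb u) ->
  exists c : V -> 'I_N.+1, forall u v, E u v -> u != v -> c u != c v.
Proof.
move=> nbN Enb.
have free (s : seq 'I_N.+1) : (size s <= N)%N -> {x | x \notin s}.
  move=> sN; apply/sigW/existsP; apply: contraT => /existsPn all_s.
  have : (#|'I_N.+1| <= size s)%N.
    apply: leq_trans (card_size s); apply: subset_leq_card; apply/fintype.subsetP => x _.
    by have := all_s x; rewrite negbK.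
  by rewrite card_ord ltnNge sN.
have sz (c : V -> 'I_N.+1) v : (size (map c (nb v)) <= N)%N by rewrite size_map.
(* After [n] rounds the vertices of code below [n] have their final colour and the others the
   default [ord0]. A new colour avoids the current colours of all listed neighbours; avoiding
   defaults as well does no harm. *)
pose col := fix col n : V -> 'I_N.+1 := if n is n'.+1 then
  (fun v => if pickle v == n' then sval (free _ (sz (col n') v)) else col n' v)
  else (fun=> ord0).
have colE n v : (pickle v < n)%N -> col n v = col (pickle v).+1 v.
  elim: n => // n IHn; rewrite ltnS leq_eqVlt => /predU1P[<-//|vn].
  by rewrite -(IHn vn) [LHS]/= (ltn_eqF vn).
have lt_neq u v : u \in nb v -> (pickle u < pickle v)%N ->
    col (pickle u).+1 u != col (pickle v).+1 v.
  move=> uv uv'; rewrite -(colE _ _ uv') [X in _ != X]/= eqxx.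
  have := svalP (free _ (sz (col (pickle v)) v)).
  by apply: contra => /eqP <-; exact: map_f.
exists (fun v => col (pickle v).+1 v) => u v /Enb[uv vu] uNv.
have := contra_neq (pcan_inj (@pickleK V) (x1 := u) (x2 := v)) uNv.
by rewrite neq_ltn => /orP[] /lt_neq; [apply|rewrite eq_sym; apply].
Qed.

Lemma map_cat3 (T : eqType) (g : T -> T) (p q x y : seq T) :
  map g (p ++ x ++ q) = p ++ y ++ q -> size x = size y ->
  {in p ++ q, g =1 id} /\ map g x = y.
Proof.
move=> + xy; rewrite !map_cat => /eqP.
rewrite eqseq_cat ?size_map// eqseq_cat ?size_map// => /and3P[/eqP gp /eqP gx /eqP gq].
split=> // z; rewrite mem_cat.
have fixp s : map g s = s -> z \in s -> g z = id z.
  by move=> gs; apply: (@eq_in_map _ _ g id s).2; rewrite map_id.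
by case/orP; exact: fixp.
Qed.

Section Null.
Variables (T : countType) (G : permgroup T) (M : ptopologicalType) (R : realType).
Variables (act : (T -> T) -> M -> M) (lt : M -> rel T).
Hypothesis Mmin : gminimal G act.
Hypothesis O : gorder G act lt.
Hypothesis ram : ramsey_group G.
Variable mu : probability (borel M) R.
Hypothesis imu : ginvariant G act mu.
Implicit Types (m n : M) (a v : T) (l k s w x : seq T) (g h : T -> T).

Let tr m : transitive (lt m). Proof. exact: (@go_tr _ _ _ _ _ O m). Qed.

Variables (low high : seq T) (a0 : T) (as1 : seq T) (b : T) (m1 m2 : M).
Let as_ := a0 :: as1.
Hypothesis m1P : cyl lt (low ++ b :: as_ ++ high) m1.
Hypothesis m2P : cyl lt (low ++ as_ ++ b :: high) m2.

Let l := low ++ as_ ++ high.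
Let fixing g := G g /\ {in l, g =1 id}.
Let orb v := exists2 g, fixing g & v = g b.

Lemma map_fixing g s : {in l, g =1 id} -> {subset s <= l} -> map g s = s.
Proof. by move=> gl sl; rewrite -[RHS]map_id; apply/eq_in_map => x /sl/gl. Qed.

Lemma low_l : {subset low <= l}. Proof. by move=> x xl; rewrite !mem_cat xl. Qed.
Lemma high_l : {subset high <= l}.
Proof. by move=> x xl; rewrite !mem_cat xl !orbT. Qed.
Lemma as_l : {subset as_ <= l}.
Proof. by move=> x xl; rewrite !mem_cat xl orbT. Qed.

Lemma notin_l : b \notin l.
Proof.
have := sorted_uniq_lt O m1P; rewrite cat_uniq => /and3P[_ /hasPn/(_ b)].
rewrite mem_head => /(_ isT) /= bl /andP[bah _].
by rewrite mem_cat negb_or bl.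
Qed.

Lemma fixing_comp g h : fixing g -> fixing h -> fixing (g \o h).
Proof.
move=> [Gg gl] [Gh hl]; split; first exact: pgM.
by move=> x xl /=; rewrite hl// gl.
Qed.

Lemma orb_fixing g v : fixing g -> orb v -> orb (g v).
Proof. by move=> fg [h fh ->]; exists (g \o h) => //; exact: fixing_comp. Qed.

(* The swap of the two patterns rotates [b :: as_] over [low] and [high]. *)
Lemma rotation : exists2 g, G g &
  {in low ++ high, g =1 id} /\ map g (b :: as_) = rcons as_ b.
Proof.
have [|g Gg gE] := cyl_transport O _ m1P m2P.
  by apply: perm_mem; rewrite perm_cat2l (perm_catCA [:: b] as_ high).
exists g => //; apply: (@map_cat3 _ g low high (b :: as_) (rcons as_ b)).
  by rewrite cat_rcons.
by rewrite size_rcons.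
Qed.

(** * The orbit of [b] over the list is infinite *)

Section FiniteOrbit.
Variable L : seq T.
Hypothesis orbL : forall v, orb v -> v \in L.

Let as0 := belast a0 as1.
Let z := last a0 as1.
Let as_rcons : as_ = rcons as0 z. Proof. exact: lastI. Qed.

(** A vertex is a copy of [l], listed as [map g l]. A neighbour drops the last entry of the segment
    and puts an orbit point in front, or drops the first and puts one behind. As the orbit lies in
    [L], the degree is bounded. *)
Let nbr (u : seq T) : seq (seq T) :=
  if pselect (exists2 g, G g & map g l = u) is left uP then
    let g := s2val (cid2 uP) in
    [seq map g (low ++ v :: as0 ++ high) | v <- L] ++
    [seq map g (low ++ as1 ++ v :: high) | v <- L]
  else [::].

Let edge (u v : seq T) := exists2 h, G h &
  u = map h l /\ v = map h (low ++ b :: as0 ++ high).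

Let edge_neq (u v : seq T) : edge u v -> u != v.
Proof.
move=> [h Gh [-> ->]]; apply/eqP => uv.
have : h b \in map h l by rewrite uv map_f// mem_cat mem_head orbT.
by rewrite mem_map ?(negbTE notin_l)//; exact: (G_inj Gh).
Qed.

(** Group elements giving the same vertex differ by one in [fixing], which only replaces [b] by
    another orbit point. For the incoming edge, [rotation] shows that its end is again a copy of
    [l]. *)
Let edge_nbr (u v : seq T) : edge u v -> u \in nbr v /\ v \in nbr u.
Proof.
have as0_l : {subset as0 <= l}.
  by move=> x xa; apply: as_l; rewrite as_rcons mem_rcons inE xa orbT.
have as1_l : {subset as1 <= l}.
  by move=> x xa; apply: as_l; rewrite inE xa orbT.
have fix_of g h : G g -> G h -> map g l = map h l -> fixing (ginv g \o h).
  move=> Gg Gh gh; split; first by apply: pgM => //; exact: ginv_in.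
  by move=> x xl /=; have /eq_in_map/(_ x xl) <- := gh; rewrite (ginvK Gg).
move=> [h Gh [uE vE]]; split.
  have [s Gs [sf]] := rotation; rewrite [map _ _]/= => -[sb].
  rewrite -[s a0 :: _]/(map s as_) => sas.
  have sas0 : map s (b :: as0) = as_.
    have : map s (b :: as_) = rcons as_ b by rewrite map_cons sb sas.
    by rewrite as_rcons -rcons_cons map_rcons => /rcons_inj[].
  have GhsV : G (h \o ginv s) by apply: pgM => //; exact: ginv_in.
  have fixs k : {subset k <= low ++ high} -> map s k = k.
    by move=> kl; rewrite -[RHS]map_id; apply/eq_in_map => x /kl/sf.
  have slow : map s low = low by apply: fixs => x; rewrite mem_cat => ->.
  have shigh : map s high = high by apply: fixs => x; rewrite mem_cat orbC => ->.
  have sVE k k' : map s k = k' -> map (h \o ginv s) k' = map h k.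
    by move=> <-; rewrite -map_comp; apply: eq_map => x /=; rewrite (ginvK Gs).
  have vl : map (h \o ginv s) l = v.
    rewrite vE; apply: sVE; rewrite map_cat slow -cat_cons map_cat sas0 shigh //.
  rewrite /nbr; case: pselect => [vP|[]]; last by exists (h \o ginv s).
  case: (cid2 vP) => g Gg gl /=.
  have ft : fixing (ginv g \o (h \o ginv s)) by apply: fix_of => //; rewrite gl vl.
  rewrite mem_cat; apply/orP; right; apply/mapP.
  set t := ginv g \o (h \o ginv s) in ft.
  exists (t b); first by apply: orbL; exists t.
  have -> : low ++ as1 ++ t b :: high = map t (low ++ as1 ++ b :: high).
    rewrite !map_cat /= !(map_fixing ft.2)//; [exact: high_l|exact: low_l].
  rewrite -map_comp (eq_map (g := h \o ginv s)); last first.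
    by move=> x; rewrite /t /= (Kginv Gg).
  rewrite uE; symmetry; apply: sVE.
  by rewrite !map_cat slow shigh sas -cats1 -catA.
rewrite /nbr; case: pselect => [uP|[]]; last by exists h.
case: (cid2 uP) => g Gg gl /=.
have ft : fixing (ginv g \o h) by apply: fix_of => //; rewrite gl uE.
rewrite mem_cat; apply/orP; left; apply/mapP.
set t := ginv g \o h in ft.
exists (t b); first by apply: orbL; exists t.
have -> : low ++ t b :: as0 ++ high = map t (low ++ b :: as0 ++ high).
  by rewrite map_cat /= map_cat !(map_fixing ft.2)//; [exact: high_l|exact: low_l].
rewrite -map_comp vE; apply: eq_map => x; by rewrite /t /= (Kginv Gg).
Qed.

(** In a proper colouring no edge is monochromatic, yet a Ramsey copy of [low ++ b :: as_ ++ high]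
    contains both ends of an edge. *)
Lemma orb_finite_absurd : False.
Proof.
have nbrN u : (size (nbr u) <= size L + size L)%N.
  by rewrite /nbr; case: pselect => //= ?; rewrite size_cat !size_map.
have [c cP] := greedy_coloring nbrN edge_nbr.
(* The colour of a set is that of its enumeration increasing at [m1]. *)
pose chi (S : set T) := c (xget [::] [set w | cyl lt w m1 /\ [set` w] = S]).
have chiE w : cyl lt w m1 -> chi [set` w] = c w.
  move=> mw; congr c; apply: xget_unique => [|w' [mw' w'w]]; first by [].
  by apply: (sorted_eq_lt O _ mw' mw); exact: set_seq_eq.
pose t := low ++ b :: as_ ++ high.
have [C CP] := ram 'I_(size L + size L).+1 l t.
have [h0 [Gh0 _ [i iP]]] := CP chi.
have [w mw wt] := exists_sorted O m1 (map h0 t).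
(* The list [map h0 t] need not be increasing at [m1]. Composing with [k] makes it so, and [chi]
   then reads the colours of [map h l] and [map h l']. *)
have [||k Gk kE] := cyl_transport O (m := act h0 m1) (n := m1) (l := map h0 t) _ _ mw.
- by move=> x; rewrite wt.
- by rewrite (cyl_act O).
have Gh : G (k \o h0) by exact: pgM.
have ht : map (k \o h0) t = w by rewrite map_comp.
move: (k \o h0) Gh ht => h {k Gk kE} Gh ht.
have [s Gs [sf sE]] := rotation.
have sas0 : map s (b :: as0) = as_.
  by move: sE; rewrite as_rcons -rcons_cons map_rcons => /rcons_inj[].
have GhsV : G (h \o ginv s) by apply: pgM => //; exact: ginv_in.
pose l' := low ++ b :: as0 ++ high.
have lE : map s l' = l.
  have fixs q : {subset q <= low ++ high} -> map s q = q.
    by move=> ql; rewrite -[RHS]map_id; apply/eq_in_map => x /ql/sf.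
  rewrite /l' map_cat -cat_cons map_cat sas0 !fixs// => x; rewrite mem_cat => ->//.
  by rewrite orbT.
have l'E : map h l' = map (h \o ginv s) l.
  by rewrite -lE -map_comp; apply: eq_map => x /=; rewrite (ginvK Gs).
have sub1 : subseq l t by apply: cat_subseq => //; exact: subseq_cons.
have sub2 : subseq l' t.
  rewrite /l' /t as_rcons cat_rcons; apply: cat_subseq => //.
  by rewrite -!cat_cons; apply: cat_subseq => //; exact: subseq_cons.
have msub q : subseq q t -> cyl lt (map h q) m1.
  move=> qt; have : subseq (map h q) w by rewrite -ht; exact: map_subseq.
  by move=> /(subseq_sorted (@tr m1)); apply.
have wsub q : subseq q t -> {subset map h q <= map h0 t}.
  by move=> /(map_subseq h)/mem_subseq qt x /qt; rewrite ht wt.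
have c1 := iP _ Gh (wsub _ sub1); rewrite chiE in c1; last exact: msub.
have c2 := iP _ GhsV; rewrite -l'E chiE in c2; last exact: msub.
have e : edge (map h l) (map h l') by exists h.
have := cP _ _ e (edge_neq e); rewrite c1 (c2 (wsub _ sub2)); by rewrite eqxx.
Qed.

End FiniteOrbit.

Lemma orb_infinite N : exists e, [/\ uniq e, size e = N & forall v, v \in e -> orb v].
Proof.
elim: N => [|N [e [ue eN eP]]]; first by exists [::].
have [v [ov ve]] : exists v, orb v /\ v \notin e.
  apply: contrapT => /forallNP nv; apply: (@orb_finite_absurd e) => v ov.
  by apply/negPn/negP => ve; apply: (nv v).
exists (v :: e); split; rewrite /= ?ve ?eN// => y.
by rewrite inE => /predU1P[->|/eP].
Qed.

(** * Moving the segment onto blocks of orbit points *)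

Let moves w g := [/\ G g, {in low ++ high, g =1 id} & map g w = as_].
(** [v] lies over the block [w] as an orbit point lies over [as_]. By [link_orb] the choice of [g]
    is immaterial. *)
Let link w v := exists2 g, moves w g & orb (g v).

Lemma moves_fixing w g h : moves w g -> moves w h -> fixing (g \o ginv h).
Proof.
move=> [Gg gf gw] [Gh hf hw]; split; first by apply: pgM => //; exact: ginv_in.
have hV y : y \in low ++ high -> ginv h y = y.
  by move=> yl; rewrite -{1}(hf y yl) (ginvK Gh).
move=> y; rewrite !mem_cat orbCA => /orP[|yl] /=; last first.
  by rewrite hV ?gf// mem_cat.
rewrite -hw => /mapP[c cw ->]; rewrite (ginvK Gh).
by have /eq_in_map/(_ c cw) := etrans gw (esym hw).
Qed.

Lemma link_orb w v g : link w v -> moves w g -> orb (g v).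
Proof.
move=> [h hw ov] gw; have := orb_fixing (moves_fixing gw hw) ov.
by have [Gh _ _] := hw; rewrite /= (ginvK Gh).
Qed.

(** The transport between the two patterns carries [rcons w v ++ as_] to [as_ ++ x] entry by entry.
    By lengths, [w] goes to [as_] and [v] to the head of [x], an orbit point. *)
Lemma link_intro m n w v x : size w = size as_ ->
  cyl lt (low ++ rcons w v ++ as_ ++ high) m ->
  cyl lt (low ++ as_ ++ x ++ high) n -> x =i rcons w v ->
  (forall y, y \in x -> orb y) -> link w v.
Proof.
move=> wa mP nP xw xorb.
have uw : uniq (rcons w v).
  by have := sorted_uniq_lt O mP; rewrite catA !cat_uniq => /and3P[/and3P[]].
have ux : uniq x.
  have := sorted_uniq_lt O nP; rewrite catA catA cat_uniq => /and3P[].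
  by rewrite cat_uniq => /and3P[].
have szx : size x = (size as_).+1.
  by rewrite (perm_size (uniq_perm ux uw xw)) size_rcons wa.
have [|g Gg gE] := cyl_transport O _ mP nP.
  apply: perm_mem; rewrite perm_cat2l perm_catCA perm_cat2l perm_cat2r.
  by rewrite perm_sym; exact: uniq_perm.
have [||gf] := @map_cat3 _ g low high (rcons w v ++ as_) (as_ ++ x).
- by rewrite -!catA.
- by rewrite !size_cat size_rcons szx wa addnC.
rewrite map_cat map_rcons cat_rcons => /eqP; rewrite eqseq_cat ?size_map//.
move=> /andP[/eqP gw /eqP gx]; exists g; first by split.
by apply: xorb; rewrite -gx mem_head.
Qed.

(** A mover of [v :: w] followed by the inverse of [t \o s] sends [rcons w v'] to [as_] and [v] to
    [b]. This gives links from a block to a point below it. *)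
Lemma link_rot v w v' : link (v :: w) v' -> link (rcons w v') v.
Proof.
move=> [g [Gg gf gw] [t ft gv']]; have [s Gs [sf sE]] := rotation.
have [Gt tl] := ft; have Gts : G (t \o s) by exact: pgM.
have Gk : G (ginv (t \o s)) by exact: ginv_in.
have inl y : y \in low ++ high -> y \in l.
  by rewrite !mem_cat => /orP[] ->; rewrite ?orbT.
have moveV c c' : t (s c) = c' -> ginv (t \o s) c' = c.
  by move=> <-; rewrite -[t (s c)]/((t \o s) c) (ginvK Gts).
have [sb sas] : s b = a0 /\ map s as_ = rcons as1 b by case: sE.
have [gv gw'] : g v = a0 /\ map g w = as1 by case: gw.
exists (ginv (t \o s) \o g).
  split; first exact: pgM.
    by move=> y yl /=; rewrite gf//; apply: moveV; rewrite sf// tl// inl.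
  rewrite map_comp map_rcons gw' gv' -[RHS]map_id.
  have -> : rcons as1 (t b) = map (t \o s) as_.
    rewrite map_comp sas map_rcons (map_fixing tl)// => y ya.
    by apply: as_l; rewrite inE ya orbT.
  by rewrite -map_comp; apply: eq_map => y /=; apply: moveV.
rewrite /= gv (moveV b).
  by exists id => //; split; [exact: pg1|].
by rewrite sb tl// as_l// mem_head.
Qed.

(** Failure of [extends] for the position of [b] between [low] and [as_]. *)
Definition missing : set M := [set m | cyl lt l m /\
  forall g, fixing g -> ~ cyl lt (low ++ g b :: as_ ++ high) m].

Lemma missing_closed : closed missing.
Proof.
have -> : missing = cyl lt l `&` \bigcap_(g in [set g | fixing g])
    ~` cyl lt (low ++ g b :: as_ ++ high).
  by apply/seteqP; split=> m [ml mP]; split=> // g fg; exact: mP.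
apply: closedI; first exact: cyl_closed O l.
by apply: closed_bigI => g _; apply/open_closedC; exact: cyl_open O _.
Qed.

Lemma moves_cyl g m v w : moves (v :: w) g -> cyl lt l (act g m) ->
  cyl lt (low ++ (v :: w) ++ high) m.
Proof.
move=> [Gg gf gw]; have -> : l = map g (low ++ (v :: w) ++ high).
  rewrite !map_cat gw; congr (_ ++ (_ ++ _)); rewrite -[LHS]map_id;
    by apply/eq_in_map => y yl; rewrite gf// mem_cat yl ?orbT.
by rewrite (cyl_act O).
Qed.

Lemma missing_lt m v w v' w' g g' : v != v' ->
  moves (v :: w) g -> moves (v' :: w') g' ->
  link (v :: w) v' -> missing (act g m) -> cyl lt l (act g' m) -> lt m v v'.
Proof.
move=> vv' gw gw' vlink [mg mgP] mg'.
have := moves_cyl gw mg; have := moves_cyl gw' mg'.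
rewrite /cyl /= !(sorted_pairwise (@tr m)) !pairwise_cat /=.
rewrite !allrel_consr => /and3P[/andP[lowv' _] _ _].
move=> /and3P[/andP[lowv lowr] plow /andP[vr pr]].
have := go_tot O m vv'; case: (lt m v v') => //= v'v.
have [f ff fE] := link_orb vlink gw.
case: (mgP f ff); rewrite -fE.
have [Gg gf gvw] := gw.
have -> : low ++ g v' :: as_ ++ high = map g (low ++ v' :: (v :: w) ++ high).
  rewrite map_cat map_cons map_cat gvw; congr (_ ++ _ :: _ ++ _);
    rewrite -[LHS]map_id; by apply/eq_in_map => y yl; rewrite gf// mem_cat yl ?orbT.
rewrite (cyl_act O)// /cyl /= -/(sorted _ _) (sorted_pairwise (@tr m)).
rewrite pairwise_cat !allrel_consr lowv lowv' lowr plow /= v'v vr pr !andbT.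
by apply/allP => y /(allP vr); exact: tr.
Qed.

Lemma missing_disjoint m v w v' w' g g' : v != v' ->
  moves (v :: w) g -> moves (v' :: w') g' ->
  link (v :: w) v' -> link (v' :: w') v ->
  missing (act g m) -> missing (act g' m) -> False.
Proof.
move=> vv' gw gw' lk lk' mg mg'.
have v'v : v' != v by rewrite eq_sym.
have [+ _] := mg; have [+ _] := mg' => mg'l mgl.
have := tr (missing_lt vv' gw gw' lk mg mg'l) (missing_lt v'v gw' gw lk' mg' mgl).
by rewrite (go_irr O).
Qed.

Lemma sorted_between m p w q : sorted (lt m) (p ++ q) -> sorted (lt m) w ->
  (forall c, c \in w -> sorted (lt m) (p ++ c :: q)) -> sorted (lt m) (p ++ w ++ q).
Proof.
rewrite !(sorted_pairwise (@tr m)) !pairwise_cat => /and3P[pq pp qq] ww wP.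
have cP c : c \in w -> all (lt m ^~ c) p /\ all (lt m c) q.
  move=> /wP; rewrite (sorted_pairwise (@tr m)) pairwise_cat allrel_consr.
  by move=> /and3P[/andP[pc _] _ /andP[cq _]].
rewrite allrel_catr pq pp qq ww !andbT /=; apply/andP; split.
  by apply/allrelP => c c' cp /cP[/allP/(_ c cp)].
by apply/allrelP => c c' /cP[_ /allP cq] /cq.
Qed.

Lemma ex_mulrn_gt (p : R) (k : nat) : (0 < p)%R -> exists N, (k%:R < p *+ N)%R.
Proof.
move=> p0; exists (Num.truncn (k%:R / p)%R).+1.
by rewrite -[(p *+ _)%R]mulr_natl -ltr_pdivrMr// truncnS_gt.
Qed.

Lemma mu_orb v : orb v ->
  mu (cyl lt (low ++ v :: as_ ++ high)) = mu (cyl lt (low ++ b :: as_ ++ high)) /\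
  mu (cyl lt (low ++ as_ ++ v :: high)) = mu (cyl lt (low ++ as_ ++ b :: high)).
Proof.
move=> [g [Gg gl] ->]; split.
  rewrite -[RHS](mu_cyl_map O _ imu Gg) map_cat map_cons map_cat.
  by rewrite !(map_fixing gl)//; first [exact: low_l|exact: high_l|exact: as_l].
rewrite -[RHS](mu_cyl_map O _ imu Gg) !map_cat map_cons.
by rewrite !(map_fixing gl)//; first [exact: low_l|exact: high_l|exact: as_l].
Qed.

Lemma overlap_orb (Q : T -> set (borel M)) (A : set (borel M)) (k : nat) :
  (0 < fine (mu A))%R -> measurable A ->
  (forall v, orb v -> measurable (Q v) /\ mu (Q v) = mu A) ->
  exists N, forall e, uniq e -> (N <= size e)%N -> (forall v, v \in e -> orb v) ->
  exists m e', [/\ uniq e', (k <= size e')%N, {subset e' <= e} &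
    forall v, v \in e' -> Q v m].
Proof.
move=> A0 mA QP; have [N kN] := ex_mulrn_gt k A0.
exists N => e ue Ne eorb.
have [||m] := overlap (mu := mu) (l := e) (Q := Q) (p := fine (mu A)) (k := k).
- move=> v /eorb/QP[mQ muQ]; split=> //.
  by rewrite muQ fineK//; exact: fin_num_measure.
- by apply: lt_le_trans kN _; apply: ler_wpMn2l => //; exact: ltW.
rewrite -size_filter => /ltnW km.
exists m, [seq v <- e | m \in Q v]; split=> //; first exact: filter_uniq.
  by move=> v; rewrite mem_filter => /andP[].
by move=> v; rewrite mem_filter => /andP[/set_mem].
Qed.

(** Two overlaps in succession: among many orbit points, [N2] lie below [as_] at a common [m], and
    among these [k] lie above [as_] at a common [n]. *)
Lemma gap_points (k : nat) : exists e m n, [/\ (k <= size e)%N, sorted (lt m) e &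
  forall v, v \in e -> [/\ orb v, cyl lt (low ++ v :: as_ ++ high) m
    & cyl lt (low ++ as_ ++ v :: high) n]].
Proof.
have [|||N2 N2P] := overlap_orb (Q := fun v => cyl lt (low ++ as_ ++ v :: high))
    (A := cyl lt (low ++ as_ ++ b :: high)) k.
- by apply: (mu_cyl_gt0 O imu); exists m2.
- exact: cyl_borel O _.
- by move=> v ov; split; [exact: cyl_borel O _|case: (mu_orb ov)].
have [|||N1 N1P] := overlap_orb (Q := fun v => cyl lt (low ++ v :: as_ ++ high))
    (A := cyl lt (low ++ b :: as_ ++ high)) N2.
- by apply: (mu_cyl_gt0 O imu); exists m1.
- exact: cyl_borel O _.
- by move=> v ov; split; [exact: cyl_borel O _|case: (mu_orb ov)].
have [e0 [ue0 se0 e0orb]] := orb_infinite N1.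
have [|m [e1 [ue1 se1 e10 e1P]]] := N1P e0 ue0 _ e0orb; first by rewrite se0.
have [|n [e2 [ue2 se2 e21 e2P]]] := N2P e1 ue1 se1.
  by move=> v /e10/e0orb.
have [e se ee2] := exists_sorted O m e2.
exists e, m, n; split=> //.
  by rewrite (perm_size (uniq_perm (sorted_uniq_lt O se) ue2 ee2)).
by move=> v; rewrite ee2 => ve; split; [exact/e0orb/e10/e21|exact/e1P/e21|exact: e2P].
Qed.

Lemma missing_null : mu (missing : set (borel M)) = 0%E.
Proof.
have mmis : measurable (missing : set (borel M)).
  by apply: closed_borel; exact: missing_closed.
apply/eqP; apply: contraT => mu0.
have r0 : (0 < fine (mu missing))%R.
  rewrite fine_gt0// lt_neqAle eq_sym mu0 measure_ge0 /=.
  by rewrite ltey_eq fin_num_measure.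
(* [N] events with the measure of [missing] cannot be pairwise disjoint. *)
have [N N1] := ex_mulrn_gt 1 r0.
pose d := (size as1).+1.
(* As [d] is the length of [as_], the points, increasing at [m], contain [N.+1] consecutive blocks
   of that length. *)
have [e [m [n [se me eP]]]] := gap_points (N.+1 * d)%N.
pose en := nth b e.
have ml : cyl lt l m.
  have : en 0%N \in e by apply: mem_nth; apply: leq_trans se.
  move=> /eP[_ + _]; apply: (subseq_sorted (@tr m)).
  by apply: cat_subseq => //; exact: subseq_cons.
have nl : cyl lt l n.
  have : en 0%N \in e by apply: mem_nth; apply: leq_trans se.
  move=> /eP[_ _]; apply: (subseq_sorted (@tr n)).
  by apply: cat_subseq => //; apply: cat_subseq => //; exact: subseq_cons.
(* Any [d.+1] of the points, in increasing order at [m], satisfy [link_intro]: they lie below [as_]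
   at [m] and above it at [n]. *)
have lkI y u (x : T) (I : seq nat) : rcons (y :: u) x = map en I -> size u = size as1 ->
    sorted ltn I -> all (fun i => i < size e)%N I -> link (y :: u) x.
  move=> IE su sI /allP Ie.
  have mI : sorted (lt m) (rcons (y :: u) x).
    rewrite IE; apply: (homo_sorted_in (P := fun i => (i < size e)%N) (e := ltn)) => //.
      exact: (sorted_ltn_nth (@tr m) b me).
    exact/allP.
  have sub : {subset rcons (y :: u) x <= e}.
    by move=> c; rewrite IE => /mapP[i /Ie ie ->]; exact: mem_nth.
  have [w nw wE] := exists_sorted O n (rcons (y :: u) x).
  apply: (@link_intro m n _ _ w) => //.
  - by rewrite /= su.
  - by apply: sorted_between => // c /sub/eP[].
  - rewrite catA; apply: sorted_between => //; rewrite -?catA// => c.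
    by rewrite wE => /sub/eP[_ _]; rewrite -catA.
  - by move=> c; rewrite wE => /sub/eP[].
pose v i := en (i * d)%N; pose w i := map en (iota (i * d).+1 (size as1)).
have vw i : v i :: w i = map en (iota (i * d) d) by [].
have bnd i c : (i <= N)%N -> c \in iota (i * d) d -> (c < size e)%N.
  move=> iN; rewrite mem_iota => /andP[_ ci]; apply: leq_trans se.
  by apply: leq_trans ci _; rewrite addnC -mulSn leq_mul2r ltnS iN orbT.
have bnd0 i : (i <= N)%N -> (i * d < size e)%N.
  by move=> iN; apply: (bnd i) => //; rewrite mem_iota leqnn -addn1 leq_add2l.
have below i j c : (i < j)%N -> c \in iota (i * d) d -> (c < j * d)%N.
  move=> ij; rewrite mem_iota => /andP[_ ci]; apply: leq_trans ci _.
  by rewrite addnC -mulSn leq_mul2r ij orbT.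
have lk i j : (i < j)%N -> (j <= N)%N -> link (v i :: w i) (v j).
  move=> ij jN; apply: (lkI _ _ _ (rcons (iota (i * d) d) (j * d)%N)).
  - by rewrite map_rcons.
  - by rewrite size_map size_iota.
  - rewrite -cats1 (sorted_pairwise ltn_trans) pairwise_cat; apply/and3P; split=> //.
      by rewrite allrel1r; apply/allP => c; exact: below.
    by rewrite -(sorted_pairwise ltn_trans) iota_ltn_sorted.
  - rewrite all_rcons bnd0// andTb; apply/allP => c; apply: bnd.
    by apply: leq_trans jN; exact: ltnW.
(* Block [j] without its last point, preceded by [v i], links to that last point; [link_rot] turns
   this into the wanted link. *)
have lk' i j : (i < j)%N -> (j <= N)%N -> link (v j :: w j) (v i).
  move=> ij jN; rewrite lastI; apply: link_rot.
  apply: (lkI _ _ _ ((i * d)%N :: iota (j * d) d)).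
  - by rewrite rcons_cons -lastI.
  - by rewrite size_belast size_map size_iota.
  - rewrite (sorted_pairwise ltn_trans) pairwise_cons; apply/andP; split; last first.
      by rewrite -(sorted_pairwise ltn_trans) iota_ltn_sorted.
    apply/allP => c; rewrite mem_iota => /andP[jc _].
    by apply: leq_trans jc; rewrite ltn_mul2r ij.
  - apply/allP => c; rewrite inE => /predU1P[->|]; last exact: bnd.
    by apply: bnd0; apply: leq_trans jN; exact: ltnW.
(* The mover of block [i] comes from its link to the next block, hence one block more than the [N]
   events. *)
have gex i : exists g, (i < N)%N -> moves (v i :: w i) g.
  have [iN|] := ltnP i N; last by exists id.
  by have [g gi _] := lk i i.+1 (leqnn _) iN; exists g.
have [g gP] := choice gex.
have [||x] := overlap (mu := mu) (l := iota 0 N)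
  (Q := fun i => act (g i) @^-1` missing) (p := fine (mu missing)) (k := 1).
- move=> i; rewrite mem_iota add0n => /gP[Gg _ _]; split.
    apply: closed_borel; apply: preimage_closed; last exact: missing_closed.
    by move=> ? _; exact: (flow_act_continuous Mmin).
  by rewrite imu// fineK//; exact: fin_num_measure.
- by rewrite size_iota.
rewrite -size_filter; set fl := seq.filter _ _ => fl1.
have ufl : uniq fl by rewrite filter_uniq// iota_uniq.
have all_in i : i \in fl -> (i < N)%N /\ missing (act (g i) x).
  by rewrite mem_filter mem_iota add0n => /andP[/set_mem mi iN].
move: fl1 ufl all_in; case: fl => [|i [|j k]]//= _ /andP[ijk _] all_in.
have ij : i != j by move: ijk; rewrite inE negb_or => /andP[].
have [iN xi] := all_in i (mem_head _ _).
have [|jN xj] := all_in j; first by rewrite !inE eqxx orbT.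
have vinj i' j' : (i' < N)%N -> (j' < N)%N -> (i' < j')%N -> v i' != v j'.
  move=> /ltnW/bnd0 ie /ltnW/bnd0 je ij'; apply/eqP => vE.
  have ijd : (i' * d < j' * d)%N by rewrite ltn_mul2r ij'.
  have : lt m (v i') (v j') by exact: (sorted_ltn_nth (@tr m) b me _ _ ie je ijd).
  by rewrite vE (go_irr O).
have [lij|lji|E] := ltngtP i j.
- by case: (missing_disjoint (vinj _ _ iN jN lij) (gP _ iN) (gP _ jN)
    (lk _ _ lij (ltnW jN)) (lk' _ _ lij (ltnW jN)) xi xj).
- by case: (missing_disjoint (vinj _ _ jN iN lji) (gP _ jN) (gP _ iN)
    (lk _ _ lji (ltnW iN)) (lk' _ _ lji (ltnW iN)) xj xi).
- by move: ij; rewrite E eqxx.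
Qed.

End Null.

Lemma cat_eq_cat (T : eqType) (l1 l2 k1 k2 : seq T) :
  l1 ++ l2 = k1 ++ k2 -> (size l1 <= size k1)%N ->
  exists2 s, k1 = l1 ++ s & l2 = s ++ k2.
Proof.
move=> lk lk1; exists (drop (size l1) k1).
  rewrite -{1}(cat_take_drop (size l1) k1); congr (_ ++ _).
  by rewrite -(takel_cat k2 lk1) -lk take_size_cat.
have := congr1 (drop (size l1)) lk; rewrite drop_size_cat// => ->.
by rewrite drop_cat; case: ltngtP lk1 => // ->; rewrite subnn drop0 drop_size.
Qed.

(** * Full measure of the generic points *)

Section FullMeasure.
Variables (T : countType) (G : permgroup T) (M : ptopologicalType) (R : realType).
Variables (act : (T -> T) -> M -> M).
Hypothesis Mmin : gminimal G act.
Hypothesis ram : ramsey_group G.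
Variable mu : probability (borel M) R.
Hypothesis imu : ginvariant G act mu.

Lemma extends_null_wlog (lt : M -> rel T) low s high b m1 m2 :
  gorder G act lt -> s != [::] ->
  cyl lt (low ++ b :: s ++ high) m1 -> cyl lt (low ++ s ++ b :: high) m2 ->
  mu (~` extends G lt low b (s ++ high) : set (borel M)) = 0%E.
Proof.
case: s => // a s O _ m1P m2P.
rewrite -(missing_null Mmin O ram imu m1P m2P); congr (mu _).
apply/seteqP; split=> m.
  move=> /not_implyP[ml /not_implyP[_ nP]]; split=> // g [Gg gf] mg.
  by apply: nP; exists g.
move=> [ml mP] ext; have [|g Gg [gf gm]] := ext ml; first by exists m1.
exact: mP gm.
Qed.

Lemma cyl_rev (lt : M -> rel T) l :
  cyl (fun m a b => lt m b a) (rev l) = cyl lt l.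
Proof. by apply/seteqP; split=> m; rewrite /cyl /= rev_sorted. Qed.

Lemma extends_rev (lt : M -> rel T) l1 b l2 :
  extends G (fun m a b => lt m b a) (rev l2) b (rev l1) = extends G lt l1 b l2.
Proof.
have cE c : cyl (fun m a b => lt m b a) (rev l2 ++ c :: rev l1) =
    cyl lt (l1 ++ c :: l2).
  by rewrite -[RHS]cyl_rev rev_cat rev_cons cat_rcons.
rewrite /extends; apply/seteqP; split=> m;
  rewrite /mkset -rev_cat cyl_rev cE => mP ml ne;
  have [g Gg [gf gm]] := mP ml ne; exists g => //.
- by split; [move=> x xl; apply: gf; rewrite mem_rev|rewrite -cE].
- by split; [move=> x; rewrite mem_rev; exact: gf|rewrite cE].
Qed.

(** The position never occurs, or it is forced by the list, or some [m2] puts [b] elsewhere. In the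
    last case the segment between the two places is nonempty, and order reversal reduces to the
    second place being above. *)
Lemma extends_null (lt : M -> rel T) l1 b l2 : gorder G act lt ->
  mu (~` extends G lt l1 b l2 : set (borel M)) = 0%E.
Proof.
move=> O; have setT_null : extends G lt l1 b l2 = setT ->
    mu (~` extends G lt l1 b l2 : set (borel M)) = 0%E.
  by move=> ->; rewrite setCT measure0.
have [[m1 m1P]|ne] := pselect (cyl lt (l1 ++ b :: l2) !=set0); last first.
  by apply: setT_null; apply/seteqP; split=> m // _ _ /ne.
have [all|/existsNP[m2 /not_implyP[m2l m2b]]] :=
    pselect (forall m, cyl lt (l1 ++ l2) m -> cyl lt (l1 ++ b :: l2) m).
  apply: setT_null; apply/seteqP; split=> m // _ ml _.
  by exists id; [exact: pg1|split=> //; exact: all].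
have bl : b \notin l1 ++ l2.
  have := sorted_uniq_lt O m1P; rewrite cat_uniq mem_cat negb_or.
  by move=> /and3P[_ /hasPn/(_ b)]; rewrite mem_head => /(_ isT) /= -> /andP[].
have [k1 [k2 [lk m2k]]] := sorted_insert O bl m2l.
have [lt12|lt21] := leqP (size l1) (size k1).
  have [s k1E l2E] := cat_eq_cat lk lt12.
  rewrite l2E; apply: (@extends_null_wlog lt _ s _ _ m1 m2) => //.
  - by apply: contra_notN m2b => /eqP s0; move: m2k; rewrite k1E l2E s0 cats0.
  - by rewrite -l2E.
  - by rewrite catA -k1E.
have [s l1E k2E] := cat_eq_cat (esym lk) (ltnW lt21).
rewrite -extends_rev l1E rev_cat.
apply: (@extends_null_wlog _ _ _ _ _ m1 m2); first exact: gorder_rev.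
- move: lt21; rewrite l1E size_cat -size_eq0 size_rev.
  by case: (size s) => //; rewrite addn0 ltnn.
- have -> : rev l2 ++ b :: rev s ++ rev k1 = rev (l1 ++ b :: l2).
    by rewrite l1E !rev_cat rev_cons cat_rcons.
  by rewrite cyl_rev.
- have -> : rev l2 ++ rev s ++ b :: rev k1 = rev (k1 ++ b :: k2).
    by rewrite k2E rev_cat rev_cons rev_cat cat_rcons -!catA.
  by rewrite cyl_rev.
Qed.

Lemma generic_full (lt : M -> rel T) : gorder G act lt ->
  mu (generic G lt : set (borel M)) = 1%E.
Proof.
move=> O; rewrite generic_bigcap.
pose U (i : nat) : set (borel M) :=
  if unpickle i is Some p then extends G lt p.1.1 p.1.2 p.2 else setT.
have mU i : measurable (U i).
  apply: open_borel; rewrite /U; case: unpickle => [p|]; last exact: openT.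
  exact: extends_open O _ _ _.
have mI : measurable (\bigcap_i U i) by exact: bigcap_measurable.
rewrite -[X in mu X]setCK probability_setC; last exact: measurableC.
rewrite setC_bigcap; suff -> : mu (\bigcup_i ~` U i) = 0%E by rewrite sube0.
have : mu.-negligible (\bigcup_i ~` U i).
  apply: negligible_bigcup => i; exists (~` U i); split=> //.
    exact: measurableC.
  rewrite /U; case: unpickle => [p|]; first exact: extends_null.
  by rewrite setCT measure0.
by move/measure_negligible; apply; apply: bigcup_measurable => i _; exact: measurableC.
Qed.

End FullMeasure.

(** * Automorphism groups of Fraisse limits *)

Lemma inj_surj_bij (A B : Type) (f : A -> B) :
  injective f -> (forall b, exists a, f a = b) -> bijective f.
Proof.
move=> finj fsurj; have [h hP] := choice fsurj.
by exists h => // a; apply: finj; rewrite hP.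
Qed.

Lemma List_InP (T : eqType) (x : T) (s : seq T) : List.In x s <-> x \in s.
Proof.
elim: s => [|a s IHs] //=; rewrite inE; split=> [[->|/IHs ->]|/predU1P[->|/IHs]].
- by rewrite eqxx.
- by rewrite orbT.
- by left.
- by right.
Qed.

Section Automorphisms.
Variables (L : language) (F : structure L).

Lemma automorphism1 : automorphism (id : F -> F).
Proof. by split; [split|exists id]. Qed.

Lemma automorphismM (g h : F -> F) :
  automorphism g -> automorphism h -> automorphism (g \o h).
Proof.
move=> [[gi gr] gb] [[hi hr] hb]; split; last exact: bij_comp.
split; first exact: inj_comp.
by move=> s t; rewrite hr gr.
Qed.

Lemma automorphismV (g : F -> F) : automorphism g ->
  exists2 h : F -> F, automorphism h & cancel g h /\ cancel h g.
Proof.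
move=> [[gi gr] [h gh hg]]; exists h => //; split; last by exists g.
split; first exact: can_inj hg.
move=> s t; rewrite (gr s (h \o t)); suff -> : g \o (h \o t) = t by [].
by apply/funext => i /=; rewrite hg.
Qed.

Definition aut_group : permgroup F :=
  PermGroup automorphism1 automorphismM automorphismV.

Lemma induced_inj (C : structure L) (S : set C) (x y : Defs.induced S) :
  sval x = sval y -> x = y.
Proof.
case: x y => x Sx [y Sy] /= xy; case: _ / xy Sy => Sy.
by congr exist; exact: Prop_irrelevance.
Qed.

Lemma induced_embedding (C : structure L) (S : set C) :
  embedding (sval : Defs.induced S -> C).
Proof. by split=> // x y; exact: induced_inj. Qed.

End Automorphisms.

Section AutomorphismGroup.
Variables (L : language) (K : structure L -> Prop) (F : structure L).
Variables (pk : F -> nat) (unpk : nat -> option F) (pkK : pcancel pk unpk).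
Local Notation T := (pcan_type pkK).
Local Notation G := (aut_group F : permgroup T).

(** Each instance of a relation involves finitely many points, on which [f] agrees with an
    automorphism. *)
Lemma aut_group_closed (f : T -> T) : bijective f ->
  (forall s : seq T, exists2 h, G h & {in s, h =1 f}) -> G f.
Proof.
move=> bf fP; split=> //; split; first exact: bij_inj.
move=> s t; pose cod : seq T := [seq (t i : T) | i <- enum 'I_(arity s)].
have [h [[hi hr] _] hf] := fP cod.
rewrite hr; suff -> : h \o t = f \o t by [].
by apply/funext => i /=; apply: hf; apply/mapP; exists i; rewrite ?mem_enum.
Qed.

Lemma induced_seq_finite (s : seq T) :
  finite_structure (Defs.induced ([set` s] : set F)).
Proof.
pose u := undup s.
have mu (i : 'I_(size u)) : tnth (in_tuple u) i \in s.
  by rewrite -mem_undup; exact: mem_tnth.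
exists (size u), (fun i => exist (fun x => is_true (x \in s)) _ (mu i)).
apply: inj_surj_bij => [i j [] ij|[x xs]].
  apply: val_inj => /=; have x0 := tnth (in_tuple u) i.
  apply/eqP; rewrite -(nth_uniq x0 (ltn_ord i) (ltn_ord j) (undup_uniq s)).
  by move: ij; rewrite !(tnth_nth x0) /= => ->.
have xu : (index (x : T) u < size u)%N by rewrite index_mem mem_undup.
exists (Ordinal xu); apply: induced_inj => /=.
by rewrite (tnth_nth (x : T)) /= nth_index// mem_undup.
Qed.

Hypotheses (Kfin : class_of_finite K) (Kram : ramsey_class K).
Hypotheses (Fage : age_is F K) (Fhom : ultrahomogeneous F).

Lemma K_induced_seq (s : seq T) : K (Defs.induced ([set` s] : set F)).
Proof.
apply/(Fage (induced_seq_finite s)).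
by exists sval; exact: induced_embedding.
Qed.

Let el (u : seq T) (x : T) (xu : x \in u) : Defs.induced ([set` u] : set F) :=
  exist (fun y : F => [set` u] y) x xu.

(** Embed [C] into the limit by [io]. Homogeneity extends the isomorphism of [t] with the
    monochromatic copy to an automorphism [h], and the copies of [s] inside [map h t] pull back to
    copies in [C]. *)
Lemma aut_group_ramsey : ramsey_group G.
Proof.
move=> Q s t.
have [C [KC CP]] := Kram (K_induced_seq s) (K_induced_seq t) (isT : 2 <= #|Q|.+2)%N.
have Cfin := Kfin.1 _ KC; have [io ioE] := (Fage Cfin).1 KC.
have [io_inj io_rel] := ioE; have [n [ph [ph' _ phK]]] := Cfin.
exists [seq (io (ph i) : T) | i <- enum 'I_n] => chi.
(* Encoding into [#|Q|.+2] colours meets the requirement of at least two, whatever the size of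
   [Q]. *)
pose code (q : Q) : 'I_(#|Q|.+2) := inord (enum_rank q).
have code_inj : injective code.
  have lt_code (q : Q) : (enum_rank q < #|Q|.+2)%N.
    by have := ltn_ord (enum_rank q); do 2 move/leqW.
  move=> q q' /(congr1 (@nat_of_ord _)); rewrite /code !inordK//.
  by move=> /val_inj/enum_rank_inj.
have [B' [p [[p_inj p_rel] [p' _ pK]]] [c cP]] :=
  CP (fun S => code (chi (io @` S : set T))).
pose q (x : Defs.induced ([set` t] : set F)) : Defs.induced (io @` B') :=
  exist _ (io (sval (p x))) (ex_intro2 _ _ (sval (p x)) (svalP (p x)) erefl).
have q_iso : isomorphism q.
  split.
    split=> [x y [] /io_inj/induced_inj/p_inj//|r u].
    by rewrite p_rel /= io_rel.
  apply: inj_surj_bij => [x y [] /io_inj/induced_inj/p_inj//|[y [z Bz yE]]].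
  by exists (p' (exist (fun y => B' y) z Bz)); apply: induced_inj; rewrite /= pK.
have [h [hA hE]] : exists h : T -> T, automorphism (h : F -> F) /\
    forall x : Defs.induced ([set` t] : set F), h (sval x) = sval (q x).
  exact: Fhom (induced_seq_finite t) q_iso.
exists h; split=> //.
  move=> _ /mapP[x xt ->].
  have -> : h x = io (sval (p (el xt))) by exact: (hE (el xt)).
  by apply/mapP; exists (ph' (sval (p (el xt)))); rewrite ?mem_enum ?phK.
suff codeP g : G g -> {subset map g s <= map h t} ->
    code (chi [set` map g s]) = c.
  have [[g0 [Gg0 g0s]]|none] :=
      pselect (exists g, G g /\ {subset map g s <= map h t}).
    exists (chi [set` map g0 s]) => g Gg gs; apply: code_inj.
    by rewrite !codeP.
  by exists (chi set0) => g Gg gs; case: none; exists g.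
move=> [[g_inj g_rel] g_bij] gs.
pose S : set C := [set y | (io y : T) \in map g s].
have gio (x : Defs.induced ([set` s] : set F)) :
    exists y : Defs.induced S, io (sval y) = g (sval x).
  case: x => x xs /=; have gx : (g x : T) \in map g s by exact: map_f.
  have /mapP[z zt gz] := gs _ gx.
  have hz : h z = io (sval (p (el zt))) by exact: (hE (el zt)).
  have Sy : S (sval (p (el zt))) by rewrite /S /= -hz -gz.
  by exists (exist (fun y => S y) _ Sy); rewrite /= -hz -gz.
have SB : S `<=` B'.
  move=> y /gs/mapP[z zt].
  have -> : h z = io (sval (p (el zt))) by exact: (hE (el zt)).
  by move=> /io_inj ->; exact: svalP (p _).
have [r rP] := choice gio.
have r_iso : isomorphism r.
  split.
    split=> [x y xy|k u]; first by apply: induced_inj; apply: g_inj; rewrite -!rP xy.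
    rewrite /= g_rel io_rel; suff -> : g \o (fun i => sval (u i)) =
      io \o (fun i => sval ((r \o u) i)) by [].
    by apply/funext => i /=; rewrite rP.
  apply: inj_surj_bij => [x y xy|[y Sy]].
    by apply: induced_inj; apply: g_inj; rewrite -!rP xy.
  have /mapP[x xs yx] := Sy; exists (el xs); apply: induced_inj.
  by apply: io_inj; rewrite rP.
rewrite -(cP S _ SB); last by exists r.
congr (code (chi _)); apply/seteqP; split=> x /=.
  move=> /mapP[z zs ->]; have := rP (el zs) => /= <-.
  by exists (sval (r (el zs))) => //; exact: svalP (r _).
by case=> y Sy <-.
Qed.

Lemma minimal_flowP (X : topologicalType) (act : (F -> F) -> X -> X) :
  minimal_flow act <-> gminimal G act.
Proof.
have eqP : flow act <-> gflow G act.
  split=> -[Xc Xh a1 aM cont]; split=> // g x U Gg nU;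
    have [s [V [nV VP]]] := cont g x U Gg nU; exists s, V; split=> // h y Gh hs Vy;
    apply: VP => // z zs; apply: hs.
  - exact/(@List_InP T).
  - exact/(@List_InP T).
by split=> -[/eqP ? ? ?].
Qed.

End AutomorphismGroup.

(** * Unique ergodicity and the dense orbit *)

Theorem mainTheorem3 (L : language) (K : structure L -> Prop) (F : structure L)
    (R : realType) (M : ptopologicalType) (act : (F -> F) -> M -> M) :
  fraisse_class K -> ramsey_class K -> fraisse_limit K F ->
  universal_minimal_flow act ->
  (* G_K amenable: some invariant Borel probability measure on M(G_K) *)
  (exists mu : probability (borel M) R, invariant_measure act mu) ->
  exists mu : probability (borel M) R,
    [/\ invariant_measure act mu,
        (* unique ergodicity *)
        (forall nu : probability (borel M) R, invariant_measure act nu ->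
           forall A : set (borel M), measurable A -> nu A = mu A)
      & exists x : M,
          [/\ dense (g_orbit act x), G_delta (g_orbit act x),
              mu (g_orbit act x) = 1%E
            & forall y : M, dense (g_orbit act y) -> G_delta (g_orbit act y) ->
                g_orbit act y = g_orbit act x]].
Proof.
move=> [Kfin _ _ _ _] Kram [[pk pk_inj] [Fage Fhom]] [Mmin Muniv] [mu imu].
(* A partial inverse of the injection into [nat], which makes the carrier of the limit a countable
   type. *)
pose unpk i : option F :=
  if pselect (exists x, pk x = i) is left ex then Some (projT1 (cid ex)) else None.
have pkK : pcancel pk unpk.
  move=> x; rewrite /unpk; case: pselect => [ex|[]]; last by exists x.
  by congr Some; apply: pk_inj; exact: projT2 (cid ex).
pose T : countType := pcan_type pkK; pose G : permgroup T := aut_group F.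
have ram : ramsey_group G by exact: aut_group_ramsey Kfin Kram Fage Fhom.
have {}Mmin : gminimal G act by apply/minimal_flowP.
have [Y [actY [v [Ymin v_cont v_act v_lin v_sim]]]] := order_flow ram.
have [|f [[f_cont f_act] _]] := Muniv Y actY; first exact/minimal_flowP.
pose lt (m : M) : rel T := fun a b => v (f m) (a, b).
have O : gorder G act lt.
  split.
  - move=> a b; rewrite (_ : mkset _ =
      (v \o f) @^-1` [set P : relspace T | P (a, b)]).
      apply: open_comp; last first.
        by apply: (@eqon_open _ [:: a; b]) => P Q /= -> //; rewrite !inE eqxx ?orbT.
      by move=> m _; apply: continuous_comp; [exact: f_cont|exact: v_cont].
    by [].
  - by move=> m a; have [/negbTE] := v_lin (f m) a a a.
  - by move=> m b a c; have [_ + _] := v_lin (f m) a b c.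
  - by move=> m a b; have [_ _] := v_lin (f m) a b a.
  - by move=> g m a b Gg; rewrite /lt f_act// v_act// /ract /= !(ginvK (G := G)).
  - by move=> s m n; exact: v_sim.
have Gcl := @aut_group_closed L F pk unpk pkK.
exists mu; split=> //.
  by move=> nu inu A mA; exact: (mu_nu_unique O Mmin ram inu imu mA).
have full : mu (generic G lt : set (borel M)) = 1%E.
  exact: (generic_full Mmin ram imu O).
have [x gx] : generic G lt !=set0.
  apply/set0P/eqP => g0; move: full; rewrite g0 measure0 => /eqP.
  by rewrite eq_sym onee_eq0.
have orbE : g_orbit act x = generic G lt.
  apply/seteqP; split=> y; first by move=> [g Gg ->]; exact: (generic_act O).
  by move=> gy; have [g Gg yE] := generic_orbit Mmin O ram Gcl gx gy; exists g.
have orb_dense : dense (g_orbit act x).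
  move=> U U0 oU; have [g Gg Ug] := orbit_meets_open Mmin x oU U0.
  by exists (act g x); split=> //; exists g.
have orb_Gd : G_delta (g_orbit act x) by rewrite orbE; exact: generic_G_delta O.
exists x; split=> //; first by rewrite orbE.
(* Two dense [G_delta] orbits meet, hence coincide. *)
move=> y dy Gy.
have [z [[g gA zy] [h hA zx]]] := dense_G_delta_meet Mmin O ram dy Gy orb_dense orb_Gd.
have Gg : G g := gA; have Gh : G h := hA.
have yx : y = act (ginv g \o h) x.
  by rewrite (flow_actM Mmin _ (ginv_in Gg) Gh) -zx zy (flow_actK Mmin Gg).
have xy : x = act (ginv h \o g) y.
  by rewrite (flow_actM Mmin _ (ginv_in Gh) Gg) -zy zx (flow_actK Mmin Gh).
have Ggh : G (ginv g \o h) by apply: pgM => //; exact: ginv_in.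
have Ghg : G (ginv h \o g) by apply: pgM => //; exact: ginv_in.
apply/seteqP; split=> _ [k kA ->]; have Gk : G k := kA.
  by exists (k \o (ginv g \o h)); [exact: (pgM Gk Ggh)|rewrite (flow_actM Mmin _ Gk Ggh) -yx].
by exists (k \o (ginv h \o g)); [exact: (pgM Gk Ghg)|rewrite (flow_actM Mmin _ Gk Ghg) -xy].
Qed.
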